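(* There exist absolute constants $C_0>0$ and $C>0$ such that the following holds for every integer $n\ge 2$, every reference distribution $\mathbf{q}$ over $[n]$ and every $0\le\varepsilon,\delta\le 1$ with $\delta\ge \frac{C_0}{\sqrt{\log n}}$. There is an algorithm which, given the full description of $\mathbf{q}$, the parameters $\varepsilon,\delta$, and at most $C\,\frac{n}{\delta^2\log n}$ i.i.d. samples from an unknown distribution $\mathbf{p}\in\Pi_n(\mathbf{q})$, distinguishes with probability at least $2/3$ between (i) $d_{\mathrm{TV}}(\mathbf{p},\mathbf{q})\le\varepsilon$ and (ii) $d_{\mathrm{TV}}(\mathbf{p},\mathbf{q})>\varepsilon+\delta$.
   Context: $[n]=\{1,\dots,n\}$, $\mathcal{S}_n$ is the set of permutations of $[n]$, and a probability distribution over $[n]$ is identified with its probability mass function $[n]\to[0,1]$. Logarithms are to base 2. For a distribution $\mathbf{q}$ over $[n]$, $\Pi_n(\mathbf{q})=\{\mathbf{q}\circ\pi : \pi\in\mathcal{S}_n\}$ is the set of distributions equal to $\mathbf{q}$ up to a permutation of the domain. The total variation distance is $d_{\mathrm{TV}}(\mathbf{p},\mathbf{q})=\sup_{S\subseteq[n]}(\mathbf{p}(S)-\mathbf{q}(S))=\frac12\sum_{i=1}^n|\mathbf{p}(i)-\mathbf{q}(i)|$. An algorithm using $s$ samples is a (possibly randomized) map from $[n]^s$ to $\{\mathsf{yes},\mathsf{no}\}$, applied to $s$ i.i.d. samples from $\mathbf{p}$; it may depend on $n$, $\mathbf{q}$ and the parameters but not on $\mathbf{p}$. It distinguishes between (i)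 and (ii) with probability at least $2/3$ if, for every $\mathbf{p}\in\Pi_n(\mathbf{q})$ satisfying (i), it outputs $\mathsf{yes}$ with probability at least $2/3$, and for every $\mathbf{p}\in\Pi_n(\mathbf{q})$ satisfying (ii), it outputs $\mathsf{no}$ with probability at least $2/3$ (probability over the samples and the internal randomness); no requirement is made for other $\mathbf{p}$. *)

(* Defs.v *)
From mathcomp Require Import all_boot all_order all_fingroup all_algebra.
From mathcomp Require Import classical_sets reals exp.

Set Implicit Arguments.
Unset Strict Implicit.
Unset Printing Implicit Defensive.

Import Order.TTheory GRing.Theory Num.Theory.

Local Open Scope classical_set_scope.
Local Open Scope ring_scope.

(* The bound pmf x <= 1 follows from the two fields. *)
Record distr (R : realType) (T : finType) := Distr {
  pmf :> {ffun T -> R};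
  pmf_ge0 : forall x, 0 <= pmf x;
  pmf_sum1 : \sum_x pmf x = 1
}.

Definition log2 (R : realType) (x : R) : R := ln x / ln 2.

Definition prob (R : realType) (T : finType) (p : distr R T) (S : {set T}) : R :=
  \sum_(x in S) p x.

Definition dTV (R : realType) (T : finType) (p q : distr R T) : R :=
  sup [set prob p S - prob q S | S in [set: {set T}]].

(* The index set {1, ..., n} is represented by 'I_n. *)
Definition perm_class (R : realType) (n : nat) (q : distr R 'I_n) :
    set (distr R 'I_n) :=
  [set p | exists pi : 'S_n, forall i, p i = q (pi i)].

(* The law of s i.i.d. samples from p, as a mass function on s-tuples. *)
Definition iid_pmf (R : realType) (T : finType) (s : nat) (p : distr R T)
    (x : s.-tuple T) : R :=
  \prod_(i < s) p (tnth x i).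

(* A randomized map T^s -> {yes, no}: each sample tuple is sent to the law, over
   the internal randomness, of the answer, where true is yes and false is no. *)
Definition algorithm (R : realType) (T : finType) (s : nat) : Type :=
  s.-tuple T -> distr R bool.

(* The probability, over the samples from p and the internal randomness, that
   the answer is b. *)
Definition prob_answer (R : realType) (T : finType) (s : nat)
    (A : algorithm R T s) (p : distr R T) (b : bool) : R :=
  \sum_(x : s.-tuple T) iid_pmf p x * A x b.

(* No requirement is made for p in D satisfying neither P1 nor P2. *)
Definition distinguishes (R : realType) (T : finType) (s : nat)
    (A : algorithm R T s) (D P1 P2 : set (distr R T)) : Prop :=
  (forall p, D p -> P1 p -> 2 / 3 <= prob_answer A p true) /\
  (forall p, D p -> P2 p -> 2 / 3 <= prob_answer A p false).

(* Main.v *)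
Require Import Defs.
From mathcomp Require Import all_boot all_order all_fingroup all_algebra.
From mathcomp Require Import classical_sets reals topology normedtype derive.
From mathcomp Require Import sequences exp trigo.
From mathcomp Require Import ring lra.

Import Order.TTheory GRing.Theory Num.Theory.
Import numFieldNormedType.Exports.

Local Open Scope classical_set_scope.
Local Open Scope ring_scope.

Set Implicit Arguments.
Unset Strict Implicit.
Unset Printing Implicit Defensive.

(** Two independent halves of [s] samples each are drawn. Write
    [x i = s * p i] and [y i = s * q i] for the expected numbers of occurrences
    of the letter [i] in one half; then [2 * s * dTV p q] is the sum of the
    [`|x i - y i|] ([dTV_half_sum]), and it is enough to estimate this sum
    within [s * delta / 2] and to compare the estimate with
    [s * (2 * eps + delta)].

    The estimator is a sum over the letters of functions of the numbers of
    occurrences of one letter. If replacing one sample changes it by at most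
    [L], its variance is at most [2 * s * L ^+ 2] ([Ex_bounded_diff]). Since
    [s * delta ^+ 2] is of order [n / log n], there is room for [L] to be a
    small power of [n], so only the bias matters.

    For the plug-in estimator [`|N - y|] the bias is at most [Num.sqrt x]. By
    [2 * sqrt x <= x / t + t] this is affordable, after summation, as soon as
    [x] or [y] exceeds a constant times [1 / delta ^+ 2]. The hypothesis
    [delta >= C0 / sqrt (log n)] says that this threshold is at most a small
    multiple of [log n]; the letters that remain have [x] and [y] of order
    [log n].

    For these, take [m] of order [log n], a width [W] of order [m], and a
    polynomial of degree less than [m] within
    [O(sqrt (x / m) + 1 / m)] of [`|x - y|] for [x] in [[0, W]]. By the
    inequality between the means its bias is at most
    [delta * x / 16 + O(1 / (delta * m))], which sums to
    [delta * s / 16 + O(n / (delta * m))]; the second term is what dictates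
    [s] of order [n / (delta ^+ 2 * log n)]. A polynomial in [p i] of degree at
    most [s] has an unbiased estimator, and for occurrence numbers of order
    [m] this estimator is at most exponential in [m] ([abs_est_bound]), that is
    a small power of [n].

    The polynomial comes from averaging the function against a positive
    trigonometric kernel of degree less than [m], in the angular coordinate
    where polynomials of degree [k] become combinations of [cos (k * phi)]
    ([kernel_mean_approx]). The averaging moves the angle by [O(1 / m)]; near
    the endpoint 0 of the interval the corresponding move of the point is
    quadratically smaller, which is where the factor [sqrt x] comes from.

    Outside [[0, W]] the polynomial is meaningless, so the first half of the
    sample decides for each letter between the polynomial and the plug-in
    estimator, and the second half evaluates the chosen one: independence
    makes the means multiply ([diff_est_bias]). *)

(** * Expectations over i.i.d. samples *)

(** Recursion on lists, rather than a sum over tuples, makes conditioning on the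
    first sample a definitional unfolding. *)
Fixpoint Ex (R : realType) (T : finType) (p : distr R T) (s : nat)
    (f : seq T -> R) : R :=
  if s is s'.+1 then \sum_x p x * Ex p s' (fun l => f (x :: l)) else f [::].

Section Expectation.
Variables (R : realType) (T : finType) (p : distr R T).
Implicit Types (f g : seq T -> R) (s : nat).

Lemma Ex_tuple s f :
  \sum_(x : s.-tuple T) iid_pmf p x * f x = Ex p s f.
Proof.
elim: s f => [|s IH] f /=.
  rewrite (eq_bigr (fun _ => f [::])); last first.
    by move=> x _; rewrite tuple0 /iid_pmf big_ord0 mul1r.
  by rewrite big_const card_tuple expn0 /= addr0.
under [RHS]eq_bigr => x _ do rewrite -IH mulr_sumr.
rewrite pair_big /=.
rewrite (reindex (fun u : T * s.-tuple T => [tuple of u.1 :: u.2])) /=; last first.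
  exists (fun t : s.+1.-tuple T => (thead t, [tuple of behead t])).
    by move=> [x t] _ /=; congr (_, _); apply: val_inj.
  by move=> t _; rewrite -tuple_eta.
apply: eq_bigr => -[x t] _ /=.
rewrite /iid_pmf big_ord_recl /= tnth0 -mulrA; congr (_ * (_ * _)).
by apply: eq_bigr => i _; rewrite tnthS.
Qed.

Lemma eq_Ex s f g : (forall l, size l = s -> f l = g l) -> Ex p s f = Ex p s g.
Proof.
elim: s f g => [|s IH] f g fg /=; first exact: fg.
by apply: eq_bigr => x _; congr (_ * _); apply: IH => l sl; apply: fg; rewrite /= sl.
Qed.

Lemma ExD s f g : Ex p s (fun l => f l + g l) = Ex p s f + Ex p s g.
Proof.
elim: s f g => [|s IH] f g //=.
by rewrite -big_split /=; apply: eq_bigr => x _; rewrite IH mulrDr.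
Qed.

Lemma ExZ s c f : Ex p s (fun l => c * f l) = c * Ex p s f.
Proof.
elim: s f => [|s IH] f //=.
by rewrite mulr_sumr; apply: eq_bigr => x _; rewrite IH mulrCA.
Qed.

Lemma ExN s f : Ex p s (fun l => - f l) = - Ex p s f.
Proof.
by rewrite -mulN1r -ExZ; apply: eq_Ex => l _; rewrite mulN1r.
Qed.

Lemma ExB s f g : Ex p s (fun l => f l - g l) = Ex p s f - Ex p s g.
Proof. by rewrite ExD ExN. Qed.

Lemma Ex_cst s c : Ex p s (fun=> c) = c.
Proof.
by elim: s => [|s IH] //=; rewrite IH -mulr_suml pmf_sum1 mul1r.
Qed.

Lemma Ex_sum s (I : Type) (r : seq I) (P : pred I) (F : I -> seq T -> R) :
  Ex p s (fun l => \sum_(i <- r | P i) F i l) = \sum_(i <- r | P i) Ex p s (F i).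
Proof.
elim: r => [|i r IH].
  by rewrite big_nil -[RHS](Ex_cst s); apply: eq_Ex => l _; rewrite big_nil.
rewrite big_cons -IH; case Pi : (P i); rewrite -?ExD;
  by apply: eq_Ex => l _; rewrite big_cons Pi.
Qed.

Lemma ler_Ex s f g :
  (forall l, size l = s -> f l <= g l) -> Ex p s f <= Ex p s g.
Proof.
elim: s f g => [|s IH] f g fg /=; first exact: fg.
apply: ler_sum => x _; apply: ler_wpM2l; first exact: pmf_ge0.
by apply: IH => l sl; apply: fg; rewrite /= sl.
Qed.

Lemma Ex_ge0 s f : (forall l, size l = s -> 0 <= f l) -> 0 <= Ex p s f.
Proof. by move=> f0; rewrite -(Ex_cst s 0); apply: ler_Ex. Qed.

Lemma ler_norm_Ex s f : `|Ex p s f| <= Ex p s (fun l => `|f l|).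
Proof.
rewrite ler_norml -ExN; apply/andP; split; apply: ler_Ex => l _.
  by rewrite lerNl ler_normr lexx orbT.
by rewrite ler_normr lexx.
Qed.

Lemma Ex_cat s1 s2 f :
  Ex p (s1 + s2) f = Ex p s1 (fun l1 => Ex p s2 (fun l2 => f (l1 ++ l2))).
Proof.
elim: s1 f => [|s1 IH] f //=.
by apply: eq_bigr => x _; rewrite IH.
Qed.

(** Disjoint parts of the sample are independent. *)
Lemma Ex_halves s (F : seq T -> seq T -> R) :
  Ex p (s + s) (fun l => F (take s l) (drop s l)) =
  Ex p s (fun l1 => Ex p s (fun l2 => F l1 l2)).
Proof.
rewrite Ex_cat; apply: eq_Ex => l1 s1; apply: eq_Ex => l2 _.
by rewrite -s1 take_size_cat // drop_size_cat.
Qed.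

(** Nonnegativity of the variance. *)
Lemma Ex_sqr_ge s f : Ex p s f ^+ 2 <= Ex p s (fun l => f l ^+ 2).
Proof.
set mu := Ex p s f.
have : 0 <= Ex p s (fun l => (f l - mu) ^+ 2) by apply: Ex_ge0 => l _; apply: sqr_ge0.
rewrite (_ : Ex _ _ _ = Ex p s (fun l => f l ^+ 2) - mu ^+ 2) ?subr_ge0 //.
rewrite (@eq_Ex s _ (fun l => f l ^+ 2 + (- (2 * mu) * f l + mu ^+ 2))); last first.
  by move=> l _; ring.
by rewrite ExD ExD ExZ Ex_cst -/mu; ring.
Qed.

(** The Efron-Stein inequality for bounded differences, by conditioning on the
    first sample: the conditional mean has variance at most [L ^+ 2], and the
    conditional variance is handled by induction. *)
Lemma Ex_bounded_diff s f (L : R) :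
  (forall u x y v, size (u ++ x :: v) = s ->
     `|f (u ++ x :: v) - f (u ++ y :: v)| <= L) ->
  Ex p s (fun l => (f l - Ex p s f) ^+ 2) <= s%:R * L ^+ 2.
Proof.
elim: s f => [|s IH] f fL; first by rewrite /= subrr expr0n mul0r.
set g := fun x => Ex p s (fun l => f (x :: l)).
set mu := Ex p s.+1 f; have muE : mu = \sum_x p x * g x by [].
clearbody mu; rewrite /=.
have gL x y : `|g x - g y| <= L.
  rewrite /g -ExB (le_trans (ler_norm_Ex _ _)) // -[leRHS](Ex_cst s).
  by apply: ler_Ex => l sl; apply: (fL [::]); rewrite /= sl.
have muL x : (g x - mu) ^+ 2 <= L ^+ 2.
  rewrite -[(g x - mu) ^+ 2]real_normK ?num_real // ler_sqr ?nnegrE //; last exact: le_trans (gL x x).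
  rewrite (_ : g x - mu = \sum_y p y * (g x - g y)); last first.
    under eq_bigr do rewrite mulrBr.
    by rewrite big_split /= sumrN -mulr_suml pmf_sum1 mul1r muE.
  apply: (le_trans (ler_norm_sum _ _ _)).
  rewrite -[leRHS]mul1r -[X in _ <= X * _](pmf_sum1 p) mulr_suml; apply: ler_sum => y _.
  by rewrite normrM (ger0_norm (pmf_ge0 p y)) ler_wpM2l // pmf_ge0.
have step x : Ex p s (fun l => (f (x :: l) - mu) ^+ 2) <= s%:R * L ^+ 2 + L ^+ 2.
  rewrite (@eq_Ex s _ (fun l => (f (x :: l) - g x) ^+ 2 +
     (2 * (g x - mu) * (f (x :: l) - g x) + (g x - mu) ^+ 2))); last first.
    by move=> l _; ring.
  rewrite ExD ExD ExZ ExB !Ex_cst -/(g x) subrr mulr0 add0r lerD //.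
  apply: (IH (fun l => f (x :: l))) => u y z v suv.
  by apply: (fL (x :: u)); rewrite /= suv.
rewrite -[leRHS]mul1r -[X in _ <= X * _](pmf_sum1 p) mulr_suml; apply: ler_sum => x _.
by rewrite ler_wpM2l ?pmf_ge0 // -natr1 mulrDl mul1r.
Qed.

Lemma chebyshev s f (mu t V : R) : 0 < t ->
  Ex p s (fun l => (f l - mu) ^+ 2) <= V ->
  Ex p s (fun l => ((t <= `|f l - mu|)%R : nat)%:R) <= V / t ^+ 2.
Proof.
move=> t0 fV; rewrite ler_pdivlMr ?exprn_gt0 // mulrC -ExZ (le_trans _ fV) //.
apply: ler_Ex => l _; have [tf|_] := boolP (t <= `|f l - mu|); last by rewrite mulr0 sqr_ge0.
by rewrite mulr1 -(real_normK (num_real (f l - mu))) ler_sqr ?nnegrE // ltW.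
Qed.

(** * The number of occurrences of a letter in the sample *)

Variable (i : T).

Lemma Ex_countS s (g : nat -> R) :
  Ex p s.+1 (fun l => g (count_mem i l)) =
  p i * Ex p s (fun l => g (count_mem i l).+1) +
  (1 - p i) * Ex p s (fun l => g (count_mem i l)).
Proof.
rewrite /= (bigD1 i) //= eqxx; congr (_ * _ + _).
have -> : 1 - p i = \sum_(x | x != i) p x.
  by have := pmf_sum1 p; rewrite (bigD1 i) //= => <-; rewrite addrAC subrr add0r.
rewrite mulr_suml.
by apply: eq_bigr => x /negPf xi; rewrite xi.
Qed.

Lemma pmf_le1 : p i <= 1.
Proof.
have := pmf_sum1 p; rewrite (bigD1 i) //= => <-.
by rewrite lerDl sumr_ge0 // => j _; apply: pmf_ge0.
Qed.

(** The number of occurrences is binomial; this is its generating function. *)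
Lemma Ex_count_exp s (z : R) :
  Ex p s (fun l => z ^+ count_mem i l) = (1 + p i * (z - 1)) ^+ s.
Proof.
elim: s => [|s IH] //; rewrite (Ex_countS s (fun k => z ^+ k)).
under eq_Ex do rewrite exprS.
by rewrite ExZ IH exprS; ring.
Qed.

Lemma Ex_count_exp_le s (z : R) : 0 <= z ->
  Ex p s (fun l => z ^+ count_mem i l) <= expR (s%:R * p i * (z - 1)).
Proof.
move=> z0; rewrite Ex_count_exp -mulrA expRM_natl lerXn2r ?nnegrE ?expR_ge0 //.
  have := pmf_le1; have := pmf_ge0 p i; nra.
exact: expR_ge1Dx.
Qed.

(** Size-biasing: multiplying an estimator by the frequency of a letter and
    removing one occurrence multiplies its mean by the mass of the letter. *)
Lemma Ex_count_shift s (g : nat -> R) :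
  Ex p s.+1 (fun l => (count_mem i l)%:R * g (count_mem i l).-1) =
  s.+1%:R * p i * Ex p s (fun l => g (count_mem i l)).
Proof.
elim: s g => [|s IH] g.
  rewrite (Ex_countS 0 (fun k => k%:R * g k.-1)) /= mul0r mulr0 addr0; ring.
rewrite (Ex_countS _ (fun k => k%:R * g k.-1)) IH.
rewrite (@eq_Ex _ _ (fun l => g (count_mem i l) + 
  (count_mem i l)%:R * g (count_mem i l).-1.+1)); last first.
  move=> l _; rewrite -natr1 mulrDl mul1r addrC; congr (_ + _).
  by case: (count_mem i l) => [|k] //; rewrite !mul0r.
rewrite ExD (IH (fun k => g k.+1)) (Ex_countS _ g) -[s.+2%:R]natr1; ring.
Qed.

Lemma Ex_count s : Ex p s (fun l => (count_mem i l)%:R) = s%:R * p i.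
Proof.
case: s => [|s]; first by rewrite /= mul0r.
have := Ex_count_shift s (fun=> 1); rewrite Ex_cst mulr1 => <-.
by apply: eq_Ex => l _; rewrite mulr1.
Qed.

Lemma Ex_count_var s :
  Ex p s (fun l => ((count_mem i l)%:R - s%:R * p i) ^+ 2) <= s%:R * p i.
Proof.
suff -> : Ex p s (fun l => ((count_mem i l)%:R - s%:R * p i) ^+ 2) =
    s%:R * p i * (1 - p i).
  rewrite ler_piMr ?mulr_ge0 ?pmf_ge0 //; have := pmf_ge0 p i; lra.
elim: s => [|s IH]; first by rewrite /= !mul0r subrr expr0n.
rewrite (Ex_countS s (fun k => (k%:R - s.+1%:R * p i) ^+ 2)).
rewrite (@eq_Ex _ _ (fun l => ((count_mem i l)%:R - s%:R * p i) ^+ 2 +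
  (2 * (1 - p i) * ((count_mem i l)%:R - s%:R * p i) + (1 - p i) ^+ 2))); last first.
  by move=> l _; rewrite -!natr1; ring.
rewrite [in X in _ + X](@eq_Ex _ _ (fun l => ((count_mem i l)%:R - s%:R * p i) ^+ 2 +
  (- (2 * p i) * ((count_mem i l)%:R - s%:R * p i) + p i ^+ 2))); last first.
  by move=> l _; rewrite -!natr1; ring.
rewrite !(ExD, ExZ) ExN !Ex_cst Ex_count IH -natr1; ring.
Qed.

Lemma Ex_count_absdev s :
  Ex p s (fun l => `|(count_mem i l)%:R - s%:R * p i|) <= Num.sqrt (s%:R * p i).
Proof.
have x0 : 0 <= s%:R * p i by rewrite mulr_ge0 ?pmf_ge0.
rewrite -(@ler_sqr _ _ (Num.sqrt _)) ?nnegrE ?sqrtr_ge0 ?Ex_ge0 //.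
rewrite sqr_sqrtr // (le_trans (Ex_sqr_ge _ _)) // (le_trans _ (Ex_count_var s)) //.
by apply: ler_Ex => l _; rewrite real_normK ?num_real.
Qed.

End Expectation.

(** * Unbiased estimators of Chebyshev polynomials *)

(** [cheb_est c k s N] estimates, from [N] occurrences among [s] samples, the
    Chebyshev polynomial of degree [k] at [2 * (c * p i) - 1]. The recursion is
    that of the Chebyshev polynomials, where multiplication by [p i] becomes
    the size-biasing of [Ex_count_shift]. *)
Fixpoint cheb_est (R : realType) (c : R) (k s N : nat) : R :=
  if k is k1.+1 then
    if k1 is k2.+1 then
      4 * c * (N%:R / s%:R) * cheb_est c k1 s.-1 N.-1 - 2 * cheb_est c k1 s N - cheb_est c k2 s N
    else 2 * c * (N%:R / s%:R) - 1
  else 1.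

Lemma cheb_estSS (R : realType) (c : R) (k s N : nat) :
  cheb_est c k.+2 s N = 4 * c * (N%:R / s%:R) * cheb_est c k.+1 s.-1 N.-1
    - 2 * cheb_est c k.+1 s N - cheb_est c k s N.
Proof. by []. Qed.

Lemma Ex_cheb_est (R : realType) (T : finType) (p : distr R T) (i : T) (c phi : R)
    (k s : nat) :
  2 * (c * p i) - 1 = cos phi -> (k <= s)%N ->
  Ex p s (fun l => cheb_est c k s (count_mem i l)) = cos (k%:R * phi).
Proof.
move=> cphi.
suff: forall k, (forall s, (k <= s)%N ->
    Ex p s (fun l => cheb_est c k s (count_mem i l)) = cos (k%:R * phi)) /\
    (forall s, (k.+1 <= s)%N ->
    Ex p s (fun l => cheb_est c k.+1 s (count_mem i l)) = cos (k.+1%:R * phi)).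
  by move=> H; apply: (H k).1.
move=> {}k; elim: k => [|k [IH1 IH2]].
  split=> {}s ks; first by rewrite Ex_cst mul0r cos0.
  rewrite mul1r -cphi /= ExB Ex_cst; congr (_ - _).
  rewrite (@eq_Ex _ _ _ _ _ (fun l => 2 * c / s%:R * (count_mem i l)%:R)); last first.
    by move=> l _; ring.
  have s0 : s%:R != 0 :> R by rewrite pnatr_eq0 -lt0n.
  by rewrite ExZ Ex_count; field.
split=> // -[|s1] // ks; rewrite ltnS in ks.
rewrite (@eq_Ex _ _ _ _ _ (fun l => 4 * c / s1.+1%:R *
     ((count_mem i l)%:R * cheb_est c k.+1 s1 (count_mem i l).-1)
  - 2 * cheb_est c k.+1 s1.+1 (count_mem i l) - cheb_est c k s1.+1 (count_mem i l))); last first.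
  by move=> l _; rewrite cheb_estSS; ring.
rewrite !ExB ExZ (Ex_count_shift p i s1 (fun N => cheb_est c k.+1 s1 N)).
rewrite ExZ (IH2 s1 ks) (IH2 s1.+1 (leqW ks)) (IH1 s1.+1 (leqW (ltnW ks))).
have -> : k.+2%:R * phi = k.+1%:R * phi + phi by rewrite -[k.+2%:R]natr1; ring.
have -> : k%:R * phi = k.+1%:R * phi - phi by rewrite -[k.+1%:R]natr1; ring.
rewrite cosB cosD -cphi.
have s0 : s1.+1%:R != 0 :> R by rewrite pnatr_eq0.
by field; rewrite nat1r.
Qed.

(** The recursion lowers the number of samples at most [d] times, and
    [c * (N / (s - d))] bounds the argument at every stage. *)
Lemma cheb_est_bound (R : realType) (c h : R) (k d s N : nat) :
  0 <= c -> 0 <= h -> (d < s)%N -> (k <= d)%N ->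
  c * (N%:R / (s%:R - d%:R)) <= h -> `|cheb_est c k s N| <= (4 * h + 3) ^+ k.
Proof.
move=> c0 h0.
suff: forall k, (forall d s N, (d < s)%N -> (k <= d)%N ->
    c * (N%:R / (s%:R - d%:R)) <= h -> `|cheb_est c k s N| <= (4 * h + 3) ^+ k) /\
    (forall d s N, (d < s)%N -> (k < d)%N ->
    c * (N%:R / (s%:R - d%:R)) <= h -> `|cheb_est c k.+1 s N| <= (4 * h + 3) ^+ k.+1).
  by move=> H; apply: (H k).1.
have ratio d1 s1 N1 : (d1 < s1)%N -> c * (N1%:R / (s1%:R - d1%:R)) <= h ->
    0 <= c * (N1%:R / s1%:R) <= h.
  move=> ds hN.
  have s0 : 0 < s1%:R :> R by rewrite ltr0n (leq_ltn_trans _ ds).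
  rewrite mulr_ge0 ?divr_ge0 //=; apply: le_trans hN; rewrite ler_wpM2l //.
  by rewrite ler_wpM2l // lef_pV2 ?posrE ?subr_gt0 ?ltr_nat // gerBl.
move=> {}k; elim: k => [|k [IH1 IH2]].
  split=> {}d {}s {}N ds kd hN; first by rewrite /= normr1.
  have /andP[r0 rh] := ratio _ _ _ ds hN.
  by rewrite /= expr1 ler_norml -mulrA; apply/andP; split; lra.
split=> // d' s' N' ds kd hN.
have /andP[r0 rh] := ratio _ _ _ ds hN.
have t1 := IH2 _ _ _ ds (ltnW kd) hN.
have t0 := IH1 _ _ _ ds (ltnW (ltnW kd)) hN.
case: d' s' ds kd hN t1 t0 r0 rh => [|d'] [|s'] //; rewrite !ltnS => ds kd hN t1 t0 r0 rh.
have t2 : `|cheb_est c k.+1 s' N'.-1| <= (4 * h + 3) ^+ k.+1.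
  apply: (IH2 d') => //; apply: le_trans hN; rewrite ler_wpM2l //.
  rewrite (_ : s'.+1%:R - d'.+1%:R = s'%:R - d'%:R); last by rewrite -!natr1; ring.
  rewrite ler_wpM2r ?ler_nat ?leq_pred //.
  by rewrite invr_ge0 subr_ge0 ler_nat ltnW.
rewrite cheb_estSS.
set a := c * _ in r0 rh; rewrite -[4 * c * _]mulrA -/a.
clearbody a.
set B := (4 * h + 3) ^+ k.+1 in t1 t2 *.
have B0 : (4 * h + 3) ^+ k <= B.
  by rewrite /B exprS ler_peMl ?exprn_ge0 //; lra.
have -> : (4 * h + 3) ^+ k.+2 = 4 * h * B + 2 * B + B by rewrite exprS -/B; ring.
apply: (le_trans (ler_normB _ _)); apply: lerD; last exact: le_trans t0 B0.
apply: (le_trans (ler_normB _ _)); apply: lerD.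
  rewrite !normrM (ger0_norm r0) (ger0_norm (_ : 0 <= 4 :> R)) //.
  by rewrite ler_pM // ?mulr_ge0 // ler_wpM2l.
by rewrite normrM (ger0_norm (_ : 0 <= 2 :> R)) // ler_wpM2l.
Qed.

(** * A positive trigonometric kernel *)

Lemma sin_le_id (R : realType) (x : R) : 0 <= x -> sin x <= x.
Proof.
move=> x0.
have [c _] : exists2 c, c \in `[0, x] & sin x - sin 0 = cos c * (x - 0).
  apply: MVT_segment => //.
  exact: (continuous_subspaceT (@continuous_sin R)).
rewrite sin0 !subr0 => ->.
by rewrite ler_piMl // cos_le1.
Qed.

Lemma cos_ge_quad (R : realType) (x : R) : 0 <= x <= pi -> 1 - cos x <= x ^+ 2 / 2.
Proof.
case/andP=> x0 xpi.
have h0 : 0 <= x / 2 by rewrite divr_ge0.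
have s0 : 0 <= sin (x / 2) by apply: sin_ge0_pi; have := @pi_ge0 R; lra.
have sx := sin_le_id h0.
have -> : cos x = 1 - 2 * sin (x / 2) ^+ 2.
  have e : (x / 2) *+ 2 = x by rewrite mulr2n; lra.
  rewrite -[in LHS]e cos_mulr2n cos2sin2. ring.
have : sin (x / 2) ^+ 2 <= (x / 2) ^+ 2 by rewrite lerXn2r ?nnegrE.
by lra.
Qed.

(** Multiplying by [sin (pi * k / N)], which is not 0, turns the sum into a
    telescope whose ends differ by [k] periods. *)
Lemma sum_cos_nodes (R : realType) (N k : nat) (psi : R) : (0 < k < N)%N ->
  \sum_(j < N) cos (psi - 2 * pi * k%:R * j%:R / N%:R) = 0.
Proof.
case/andP=> k0 kN.
have N0 : N%:R != 0 :> R by rewrite pnatr_eq0; case: N kN.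
set al : R := pi * k%:R / N%:R.
have sal : sin al != 0.
  rewrite gt_eqF // sin_gt0_pi // /al; apply/andP; split.
    by rewrite divr_gt0 ?mulr_gt0 ?pi_gt0 ?ltr0n // (leq_ltn_trans _ kN).
  rewrite -mulrA gtr_pMr ?pi_gt0 // ltr_pdivrMr ?ltr0n ?(leq_ltn_trans _ kN) //.
  by rewrite mul1r ltr_nat.
apply: (mulfI sal); rewrite mulr0; apply: (mulfI (_ : 2 != 0 :> R)); rewrite ?pnatr_eq0 // mulr0.
pose F (j : nat) : R := sin (psi + al - 2 * al * j%:R).
have step (j : nat) : 2 * (sin al * cos (psi - 2 * pi * k%:R * j%:R / N%:R)) =
    F j - F j.+1.
  rewrite /F.
  have -> : psi + al - 2 * al * j%:R = (psi - 2 * al * j%:R) + al by ring.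
  have -> : psi + al - 2 * al * j.+1%:R = (psi - 2 * al * j%:R) - al.
    by rewrite -natr1; ring.
  have -> : psi - 2 * pi * k%:R * j%:R / N%:R = psi - 2 * al * j%:R by rewrite /al; ring.
  by rewrite sinB sinD; ring.
rewrite !mulr_sumr (eq_bigr (fun j : 'I_N => F j - F j.+1)) //.
rewrite -(big_mkord xpredT (fun j => F j - F j.+1)).
rewrite -[LHS]opprK -sumrN; under eq_bigr do rewrite opprB.
rewrite telescope_sumr // /F mulr0 subr0.
have -> : psi + al - 2 * al * N%:R = psi + al - (pi *+ 2) *+ k.
  by rewrite -(mulr_natr (pi *+ 2) k) -(mulr_natr pi 2) /al; field.
rewrite opprB -[X in sin X - _](subrK (pi *+ 2 *+ k)) periodicn ?subrr //.
exact: sinD2pi.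
Qed.

Section Kernel.
Variables (R : realType) (m : nat).
Hypothesis m_gt1 : (1 < m)%N.

Definition ang : R := pi / m%:R.
Definition weight (a : nat) : R := sin (a%:R * ang).
Definition weight_norm : R := \sum_(a < m) weight a ^+ 2.
Definition kernel (t : R) : R :=
  \sum_(a < m) \sum_(b < m) weight a * weight b * cos ((a%:R - b%:R) * t).
(* [kernel * cos] has degree at most [m], so [m.+1] nodes average it exactly. *)
Definition node (j : nat) : R := 2 * pi * j%:R / m.+1%:R.

Let m_gt0 : (0 < m)%N. Proof. exact: ltnW. Qed.
Let mR_gt0 : 0 < m%:R :> R. Proof. by rewrite ltr0n. Qed.

Lemma ang_gt0 : 0 < ang.
Proof. by rewrite divr_gt0 ?pi_gt0. Qed.

Lemma ang_le : ang <= 4 / m%:R.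
Proof. by rewrite ler_pM2r ?invr_gt0 //; have := @pihalf_lt2 R; lra. Qed.

Lemma ang_lepi : ang <= pi.
Proof. by rewrite ler_pdivrMr // ler_peMr ?pi_ge0 // ler1n. Qed.

Lemma weight_last : weight m = 0.
Proof. by rewrite /weight /ang mulrC divfK ?gt_eqF // sinpi. Qed.

Lemma weight_ge0 a : (a < m)%N -> 0 <= weight a.
Proof.
move=> am; apply: sin_ge0_pi; rewrite mulr_ge0 ?(ltW ang_gt0) //=.
rewrite /ang mulrCA ger_pMr ?pi_gt0 // ler_pdivrMr // mul1r ler_nat.
exact: ltnW.
Qed.

Lemma weight_norm_gt0 : 0 < weight_norm.
Proof.
rewrite /weight_norm (bigD1 (Ordinal m_gt1)) //= ltr_wpDr ?sumr_ge0 // => [a _|].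
  exact: sqr_ge0.
rewrite exprn_gt0 // /weight mul1r sin_gt0_pi // ang_gt0 /=.
by rewrite /ang ltr_pdivrMr // ltr_pMr ?pi_gt0 // ltr1n.
Qed.

(** The kernel is the squared modulus of the trigonometric polynomial with
    coefficients [weight]. *)
Lemma kernelE t : kernel t = (\sum_(a < m) weight a * cos (a%:R * t)) ^+ 2 +
  (\sum_(a < m) weight a * sin (a%:R * t)) ^+ 2.
Proof.
rewrite !expr2 !mulr_suml -big_split /=; apply: eq_bigr => a _.
rewrite !mulr_sumr -big_split /=; apply: eq_bigr => b _.
by rewrite mulrBl cosB; ring.
Qed.

Lemma kernel_ge0 t : 0 <= kernel t.
Proof. by rewrite kernelE addr_ge0 // sqr_ge0. Qed.

Lemma sum_cos_diff (a b : nat) (phi : R) : (a < m.+1)%N -> (b < m.+1)%N ->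
  \sum_(j < m.+1) cos ((a%:R - b%:R) * (phi - node j)) = (a == b)%:R * m.+1%:R.
Proof.
move=> am bm; case: (ltngtP a b) => [ab|ba|->].
- rewrite mul0r -[RHS](sum_cos_nodes ((b - a)%N%:R * phi) (_ : 0 < b - a < m.+1)%N).
    apply: eq_bigr => j _; rewrite -cosN; congr cos.
    by rewrite natrB ?(ltnW ab) // /node; ring.
  by rewrite subn_gt0 ab (leq_ltn_trans (leq_subr _ _)).
- rewrite mul0r -[RHS](sum_cos_nodes ((a - b)%N%:R * phi) (_ : 0 < a - b < m.+1)%N).
    apply: eq_bigr => j _; congr cos.
    by rewrite natrB ?(ltnW ba) // /node; ring.
  by rewrite subn_gt0 ba (leq_ltn_trans (leq_subr _ _)).
under eq_bigr do rewrite subrr mul0r cos0.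
by rewrite sumr_const card_ord mul1r.
Qed.

Lemma sum_kernel phi : \sum_(j < m.+1) kernel (phi - node j) = m.+1%:R * weight_norm.
Proof.
rewrite exchange_big /= /weight_norm mulr_sumr; apply: eq_bigr => a _.
rewrite exchange_big /= (bigD1 a) //= [X in _ + X]big1 ?addr0 => [|b ba].
  by rewrite -mulr_sumr sum_cos_diff ?ltnS ?(ltnW (ltn_ord a)) // eqxx mul1r; ring.
rewrite -mulr_sumr sum_cos_diff ?ltnS ?(ltnW (ltn_ord _)) //.
by move: ba; rewrite -val_eqE /= eq_sym => /negPf ->; rewrite mul0r mulr0.
Qed.

(** The weights [sin (pi * a / m)] form the Perron eigenvector of the path, for
    the eigenvalue [cos (pi / m)]. This is the reason for their choice: the
    mean of [cos] under the kernel is that eigenvalue, within [O(1 / m ^ 2)] of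
    1. *)
Lemma sum_weight_shift :
  \sum_(a < m) weight a * weight a.+1 = cos ang * weight_norm.
Proof.
have e : \sum_(a < m) weight a * weight a.+1 = \sum_(a < m) weight a * sin ((a%:R - 1) * ang).
  suff H k : weight k = 0 -> \sum_(a < k) weight a * weight a.+1 =
      \sum_(a < k) weight a * sin ((a%:R - 1) * ang) by apply: H weight_last.
  case: k => [|k] wk; first by rewrite !big_ord0.
  have w0 : weight 0 = 0 by rewrite /weight mul0r sin0.
  rewrite big_ord_recr /= wk mulr0 addr0 big_ord_recl w0 mul0r add0r.
  apply: eq_bigr => a _; rewrite mulrC; congr (_ * _).
  by rewrite /weight /= /bump /= add1n -natr1 addrK.
apply: (mulfI (_ : 2 != 0 :> R)); rewrite ?pnatr_eq0 // mulr_natl mulr2n {2}e -big_split /=.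
rewrite !mulr_sumr; apply: eq_bigr => a _.
rewrite /weight -natr1 mulrBl mulrDl mul1r sinB sinD; ring.
Qed.

Lemma sum_kernel_cos phi :
  \sum_(j < m.+1) kernel (phi - node j) * cos (phi - node j) =
  m.+1%:R * (cos ang * weight_norm).
Proof.
have kc t : kernel t * cos t = \sum_(a < m) \sum_(b < m) weight a * weight b *
    (cos ((a.+1%:R - b%:R) * t) + cos ((a%:R - b.+1%:R) * t)) / 2.
  rewrite mulr_suml; apply: eq_bigr => a _; rewrite mulr_suml; apply: eq_bigr => b _.
  have -> : (a.+1%:R - b%:R) * t = (a%:R - b%:R) * t + t by rewrite -natr1; ring.
  have -> : (a%:R - b.+1%:R) * t = (a%:R - b%:R) * t - t by rewrite -natr1; ring.
  by rewrite cosB cosD; field.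
under eq_bigr do rewrite kc.
rewrite exchange_big /=.
under eq_bigr => a _.
  rewrite exchange_big /=.
  under eq_bigr => b _.
    rewrite -mulr_suml -mulr_sumr big_split /= !sum_cos_diff ?ltnS ?ltn_ord ?(ltnW (ltn_ord _)) //.
    over.
  over.
rewrite (eq_bigr (fun a : 'I_m => \sum_(b < m) ((a.+1 == b)%:R * (weight a * weight b) * (m.+1%:R / 2)) +
   \sum_(b < m) ((a == b.+1 :> nat)%:R * (weight a * weight b) * (m.+1%:R / 2)))); last first.
  by move=> a _; rewrite -big_split /=; apply: eq_bigr => b _; ring.
rewrite big_split /= [X in _ + X]exchange_big /=.
rewrite (eq_bigr (fun a : 'I_m => weight a * weight a.+1 * (m.+1%:R / 2))); last first.
  move=> a _; case: (ltnP a.+1 m) => [am|].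
    rewrite (bigD1 (Ordinal am)) //= eqxx mul1r big1 ?addr0 // => b.
    by rewrite -val_eqE /= eq_sym => /negPf ->; rewrite !mul0r.
  rewrite leq_eqVlt ltnNge (ltn_ord a) orbF => /eqP am.
  rewrite -am weight_last mulr0 mul0r big1 // => b _.
  by rewrite gtn_eqF ?mul0r // -am ltn_ord.
rewrite [X in _ + X](eq_bigr (fun a : 'I_m => weight a * weight a.+1 * (m.+1%:R / 2))); last first.
  move=> a _; case: (ltnP a.+1 m) => [am|].
    rewrite (bigD1 (Ordinal am)) //= eqxx mul1r big1 ?addr0 => [|b].
      by rewrite (mulrC (weight a)).
    by rewrite -val_eqE /= => /negPf ->; rewrite !mul0r.
  rewrite leq_eqVlt ltnNge (ltn_ord a) orbF => /eqP am.
  rewrite -am weight_last mulr0 mul0r big1 // => b _.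
  by rewrite ltn_eqF ?mul0r // -am ltn_ord.
by rewrite -mulr_suml sum_weight_shift; field.
Qed.


Variable u : R.

(** The absolute deviation from [u], in the angular coordinate of [0, 1]. *)
Definition absdev (phi : R) : R := `|(1 + cos phi) / 2 - u|.

Definition kernel_mean (phi : R) : R :=
  (\sum_(j < m.+1) absdev (node j) * kernel (phi - node j)) / (m.+1%:R * weight_norm).

(** The increment of [cos] at [phi] is second order in [t] up to the factor
    [sin phi], and [`|sin t|] is traded for [1 - cos t], the quantity
    controlled by the kernel, by completing the square. *)
Lemma absdev_diff phi t :
  `|absdev (phi - t) - absdev phi| <=
  ((1 - cos t) * (1 + `|sin phi| / ang) + `|sin phi| * (ang / 2)) / 2.
Proof.
have a0 := ang_gt0.
apply: (le_trans (ler_dist_dist _ _)).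
have -> : (1 + cos (phi - t)) / 2 - u - ((1 + cos phi) / 2 - u) =
    (cos phi * (cos t - 1) + sin phi * sin t) / 2 by rewrite cosB; field.
rewrite normrM [X in _ * X]ger0_norm ?invr_ge0 // ler_pM2r ?invr_gt0 //.
apply: (le_trans (ler_normD _ _)); rewrite !normrM.
have c1 : 0 <= 1 - cos t by rewrite subr_ge0 cos_le1.
have st : `|sin t| <= (1 - cos t) / ang + ang / 2.
  have s2 : `|sin t| ^+ 2 <= 2 * (1 - cos t).
    rewrite real_normK ?num_real // sin2cos2.
    have := cos_le1 t; have := cos_geN1 t; nra.
  have : 0 <= (`|sin t| - ang) ^+ 2 by rewrite sqr_ge0.
  have -> : (1 - cos t) / ang + ang / 2 = (2 * (1 - cos t) + ang ^+ 2) / (2 * ang).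
    by field; rewrite gt_eqF.
  rewrite ler_pdivlMr; last lra.
  by lra.
have e : `|cos t - 1| = 1 - cos t by rewrite distrC ger0_norm.
rewrite e [in leRHS]mulrDr mulr1 -addrA lerD //.
  by rewrite ler_piMl // cos_max.
have -> : (1 - cos t) * (`|sin phi| / ang) + `|sin phi| * (ang / 2) =
  `|sin phi| * ((1 - cos t) / ang + ang / 2) by ring.
by rewrite ler_wpM2l.
Qed.

(** Averaging against the kernel, whose mean of [1 - cos] is at most
    [ang ^+ 2 / 2], displaces the angle by [O(ang)], hence the point
    [v = (1 + cos phi) / 2] only by [O(ang * sqrt v + ang ^+ 2)]. *)
Lemma kernel_mean_approx phi :
  `|kernel_mean phi - absdev phi| <=
  ang * Num.sqrt ((1 + cos phi) / 2) + ang ^+ 2 / 4.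
Proof.
have a0 := ang_gt0.
have w0 := weight_norm_gt0.
have D0 : 0 < m.+1%:R * weight_norm by rewrite mulr_gt0 ?ltr0n.
have sk := sum_kernel phi.
have skc := sum_kernel_cos phi.
have ca : 1 - cos ang <= ang ^+ 2 / 2.
  by apply: cos_ge_quad; rewrite (ltW a0) ang_lepi.
have sp : `|sin phi| <= 2 * Num.sqrt ((1 + cos phi) / 2).
  have h0 : 0 <= (1 + cos phi) / 2 by have := cos_geN1 phi; lra.
  rewrite -(@ler_sqr _ `|sin phi|) ?nnegrE ?mulr_ge0 ?sqrtr_ge0 //.
  rewrite exprMn sqr_sqrtr // real_normK ?num_real // sin2cos2.
  have := cos_le1 phi; have := cos_geN1 phi; nra.
have sn0 : 0 <= `|sin phi| by [].
have -> : kernel_mean phi - absdev phi =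
    (\sum_(j < m.+1) (absdev (node j) - absdev phi) * kernel (phi - node j)) / (m.+1%:R * weight_norm).
  under [in RHS]eq_bigr do rewrite mulrBl.
  rewrite big_split /= sumrN -mulr_sumr sk mulrBl mulfK // gt_eqF //.
rewrite normrM [X in _ * X]ger0_norm ?invr_ge0 ?(ltW D0) // ler_pdivrMr //.
apply: (le_trans (ler_norm_sum _ _ _)).
pose A := 1 + `|sin phi| / ang; pose B := `|sin phi| * (ang / 2).
apply: (@le_trans _ _ (\sum_(j < m.+1)
    (kernel (phi - node j) * ((A + B) / 2) -
     kernel (phi - node j) * cos (phi - node j) * (A / 2)))).
  apply: ler_sum => j _; rewrite normrM [X in _ * X]ger0_norm ?kernel_ge0 //.
  have := absdev_diff phi (phi - node j); rewrite subKr -/A -/B.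
  set t := cos _; have := kernel_ge0 (phi - node j); set k := kernel _.
  move=> k0 H.
  have -> : k * ((A + B) / 2) - k * t * (A / 2) = ((1 - t) * A + B) / 2 * k by field.
  by rewrite ler_wpM2r.
rewrite big_split /= sumrN -!mulr_suml sk skc.
have -> : m.+1%:R * weight_norm * ((A + B) / 2) - m.+1%:R * (cos ang * weight_norm) * (A / 2) =
   ((1 - cos ang) * A + B) / 2 * (m.+1%:R * weight_norm) by field.
rewrite ler_pM2r //.
have A0 : 0 <= A by rewrite /A addr_ge0 // divr_ge0 // ltW.
have : (1 - cos ang) * A <= ang ^+ 2 / 2 * A by rewrite ler_wpM2r.
have -> : ang ^+ 2 / 2 * A = ang ^+ 2 / 2 + ang * `|sin phi| / 2.
  by rewrite /A; field; rewrite gt_eqF.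
rewrite /B => H.
have : ang * `|sin phi| <= ang * (2 * Num.sqrt ((1 + cos phi) / 2)).
  by rewrite ler_wpM2l // ltW.
by lra.
Qed.

Definition coef (a b : nat) : R :=
  weight a * weight b / (m.+1%:R * weight_norm) * \sum_(j < m.+1) absdev (node j) * cos ((a%:R - b%:R) * node j).

(** Symmetrizing in [phi] removes the sines, leaving a polynomial in
    [cos phi]. *)
Lemma coef_cos phi :
  \sum_(a < m) \sum_(b < m) coef a b * cos ((a%:R - b%:R) * phi) =
  (kernel_mean phi + kernel_mean (- phi)) / 2.
Proof.
have w0 := weight_norm_gt0.
have D0 : 0 < m.+1%:R * weight_norm by rewrite mulr_gt0 ?ltr0n.
rewrite /kernel_mean -mulrDl -big_split /=.
have H (j : nat) : absdev (node j) * kernel (phi - node j) +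
   absdev (node j) * kernel (- phi - node j) = \sum_(a < m) \sum_(b < m)
   2 * (weight a * weight b * cos ((a%:R - b%:R) * phi) *
     (absdev (node j) * cos ((a%:R - b%:R) * node j))).
  rewrite -mulrDr -big_split mulr_sumr /=; apply: eq_bigr => a _.
  rewrite -big_split mulr_sumr /=; apply: eq_bigr => b _.
  rewrite -mulrDr !mulrBr mulrN cosB [in X in _ + X]cosB cosN sinN; ring.
under [in RHS]eq_bigr do rewrite H.
rewrite [in RHS]exchange_big /= !mulr_suml; apply: eq_bigr => a _.
rewrite [in RHS]exchange_big /= !mulr_suml; apply: eq_bigr => b _.
rewrite -mulr_sumr -mulr_sumr /coef; set S := \sum_(j < _) _.
field; rewrite nat1r !gt_eqF //.
Qed.

Lemma coef_bound : 0 <= u <= 1 -> \sum_(a < m) \sum_(b < m) `|coef a b| <= m%:R.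
Proof.
move=> /andP[u0 u1].
have w0 := weight_norm_gt0.
have D0 : 0 < m.+1%:R * weight_norm by rewrite mulr_gt0 ?ltr0n.
have t1 t : `|absdev t| <= 1.
  rewrite /absdev normr_id ler_norml.
  by have := cos_le1 t; have := cos_geN1 t => c0 c1; apply/andP; split; lra.
have cb (a b : 'I_m) : `|coef a b| <= (weight a ^+ 2 + weight b ^+ 2) / (2 * weight_norm).
  have wa := weight_ge0 (ltn_ord a); have wb := weight_ge0 (ltn_ord b).
  rewrite /coef normrM (ger0_norm (_ : 0 <= _ / _)); last first.
    by rewrite divr_ge0 ?mulr_ge0 // ltW.
  apply: (@le_trans _ _ (weight a * weight b / (m.+1%:R * weight_norm) * m.+1%:R)).
    rewrite ler_wpM2l ?divr_ge0 ?mulr_ge0 ?(ltW w0) //.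
    apply: (le_trans (ler_norm_sum _ _ _)).
    rewrite -[X in _ <= X%:R]card_ord -sumr_const; apply: ler_sum => j _.
    by rewrite normrM mulr_ile1 // cos_max.
  have -> : weight a * weight b / (m.+1%:R * weight_norm) * m.+1%:R = (2 * (weight a * weight b)) / (2 * weight_norm).
    by field; rewrite nat1r pnatr_eq0 gt_eqF.
  rewrite ler_pM2r ?invr_gt0 ?mulr_gt0 //.
  by have : 0 <= (weight a - weight b) ^+ 2 := sqr_ge0 _; lra.
apply: (@le_trans _ _ (\sum_(a < m) \sum_(b < m) (weight a ^+ 2 + weight b ^+ 2) / (2 * weight_norm))).
  by apply: ler_sum => a _; apply: ler_sum => b _.
under eq_bigr do rewrite -mulr_suml big_split /= sumr_const card_ord.
rewrite -mulr_suml big_split /= sumr_const card_ord sumrMnl -[\sum_(i < m) _]/weight_norm.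
rewrite -(mulr_natr weight_norm) le_eqVlt; apply/orP; left; apply/eqP.
by field; rewrite gt_eqF.
Qed.

(* The degree [`|a - b|] is written with truncated subtractions. *)
Definition abs_est (c : R) (s N : nat) : R :=
  \sum_(a < m) \sum_(b < m) coef a b * cheb_est c (a - b + (b - a)) s N.

Lemma Ex_abs_est (T : finType) (p : distr R T) (i : T) (c : R) (s : nat) :
  0 <= c * p i <= 1 -> (m <= s)%N ->
  `|Ex p s (fun l => abs_est c s (count_mem i l)) - `|c * p i - u| | <=
  ang * Num.sqrt (c * p i) + ang ^+ 2 / 4.
Proof.
move=> /andP[v0 v1] ms; set v := c * p i in v0 v1 *.
set phi := acos (2 * v - 1).
have cphi : cos phi = 2 * v - 1.
  by rewrite acosK // in_itv /=; apply/andP; split; lra.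
have half : (1 + cos phi) / 2 = v by rewrite cphi; field.
have -> : Ex p s (fun l => abs_est c s (count_mem i l)) = (kernel_mean phi + kernel_mean (- phi)) / 2.
  rewrite -coef_cos Ex_sum; apply: eq_bigr => a _; rewrite Ex_sum.
  apply: eq_bigr => b _; rewrite ExZ; congr (_ * _).
  rewrite (@Ex_cheb_est _ _ _ _ _ phi) //; last first.
    rewrite (leq_trans _ ms) //; case: (leqP a b) => [ab|/ltnW ab];
      rewrite (eqP ab) ?add0n ?addn0 (leq_trans (leq_subr _ _)) // ltnW //.
  case: (leqP a b) => [ab|/ltnW ab].
    by rewrite (eqP ab) add0n natrB // -cosN; congr cos; ring.
  by rewrite (eqP ab) addn0 natrB.
have k1 := kernel_mean_approx phi.
have k2 := kernel_mean_approx (- phi).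
rewrite cosN half in k2; rewrite half in k1.
rewrite /absdev cosN half in k2; rewrite /absdev half in k1.
move: k1 k2; rewrite !ler_norml => /andP[? ?] /andP[? ?].
by apply/andP; split; lra.
Qed.

Lemma abs_est_bound (c h : R) (s N : nat) : 0 <= u <= 1 ->
  0 <= c -> 0 <= h -> (m < s)%N -> c * (N%:R / (s%:R - m%:R)) <= h ->
  `|abs_est c s N| <= m%:R * (4 * h + 3) ^+ m.
Proof.
move=> u01 c0 h0 ms hN.
have H0 : 0 <= (4 * h + 3) ^+ m by rewrite exprn_ge0 //; lra.
apply: (@le_trans _ _ (\sum_(a < m) \sum_(b < m) `|coef a b| * (4 * h + 3) ^+ m)).
  apply: (le_trans (ler_norm_sum _ _ _)); apply: ler_sum => a _.
  apply: (le_trans (ler_norm_sum _ _ _)); apply: ler_sum => b _.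
  have km : (a - b + (b - a) <= m)%N.
    by case: (leqP a b) => [ab|/ltnW ab];
      rewrite (eqP ab) ?add0n ?addn0 (leq_trans (leq_subr _ _)) // ltnW //.
  rewrite normrM ler_wpM2l // (le_trans (cheb_est_bound c0 h0 ms km hN)) //.
  by rewrite ler_weXn2l //; lra.
under eq_bigr do rewrite -mulr_suml.
by rewrite -mulr_suml ler_wpM2r // coef_bound.
Qed.

End Kernel.

(** * The estimator of a single absolute difference *)

(** Crude bounds on the base of the exponential suffice for all tails. *)
Lemma expR1_ge2 (R : realType) : 2 <= expR 1 :> R.
Proof. by have := @expR_ge1Dx R 1; lra. Qed.

Lemma expR1_le4 (R : realType) : expR 1 <= 4 :> R.
Proof.
have h : 2^-1 <= expR (- 2^-1) :> R by have := @expR_ge1Dx R (- 2^-1); lra.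
have : (2^-1) ^+ 2 <= expR (- 2^-1) ^+ 2 :> R by rewrite lerXn2r ?nnegrE ?expR_ge0 ?invr_ge0.
rewrite -expRM_natl (_ : 2%:R * - 2^-1 = - 1); last by field.
rewrite expRN => H; rewrite -[4]invrK -[expR 1]invrK lef_pV2 ?posrE ?invr_gt0 ?expR_gt0 //.
by apply: le_trans H; lra.
Qed.

Lemma natr_le_exp2 (R : realType) (m : nat) : m%:R <= 2 ^+ m :> R.
Proof. by rewrite -natrX ler_nat ltnW // ltn_expl. Qed.

Lemma exp67_le (R : realType) (m : nat) : 67 ^+ m <= (2 ^+ m) ^+ 7 :> R.
Proof. by rewrite exprAC lerXn2r ?nnegrE ?exprn_ge0 // -natrX ler_nat. Qed.

Section Tails.
Variables (R : realType) (T : finType) (p : distr R T) (i : T) (s : nat).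
Local Notation x := (s%:R * p i).
Local Notation cnt := (count_mem i).

Lemma Ex_count_expR : Ex p s (fun l => expR (cnt l)%:R) <= expR (3 * x).
Proof.
rewrite (@eq_Ex _ _ _ _ _ (fun l => expR 1 ^+ cnt l)); last first.
  by move=> l _; rewrite -expRM_natl mulr1.
apply: (le_trans (Ex_count_exp_le p i s (expR_ge0 1))).
rewrite ler_expR mulrC ler_wpM2r ?mulr_ge0 ?pmf_ge0 //.
by have := @expR1_le4 R; lra.
Qed.

Lemma upper_tail (M : R) :
  Ex p s (fun l => (~~ ((cnt l)%:R <= M)%R : nat)%:R) <= expR (3 * x - M).
Proof.
rewrite expRD mulrC; apply: (@le_trans _ _ (expR (- M) * Ex p s (fun l => expR (cnt l)%:R))).
  rewrite -ExZ; apply: ler_Ex => l _; rewrite -expRD.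
  have [h|h] := boolP ((cnt l)%:R <= M); rewrite /=; first by rewrite expR_ge0.
  by rewrite -ltNge in h; apply: le_trans (expR_ge1Dx _); rewrite lerDl; lra.
by rewrite ler_wpM2l ?expR_ge0 // Ex_count_expR.
Qed.

Lemma lower_tail (M : R) :
  Ex p s (fun l => (((cnt l)%:R <= M)%R : nat)%:R) <= expR (M - x / 2).
Proof.
rewrite expRD; apply: (@le_trans _ _ (expR M * Ex p s (fun l => expR (-1) ^+ cnt l))).
  rewrite -ExZ; apply: ler_Ex => l _; rewrite -expRM_natl mulrN1 -expRD.
  have [h|h] := boolP ((cnt l)%:R <= M); rewrite /=; last by rewrite expR_ge0.
  by apply: le_trans (expR_ge1Dx _); rewrite lerDl; lra.
rewrite ler_wpM2l ?expR_ge0 //.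
apply: (le_trans (Ex_count_exp_le p i s (expR_ge0 (-1)))).
rewrite ler_expR -mulrN ler_wpM2l ?mulr_ge0 ?pmf_ge0 //.
have e2 := @expR1_ge2 R.
have : expR (-1) <= 2^-1 :> R by rewrite expRN lef_pV2 ?posrE ?expR_gt0.
by lra.
Qed.

Lemma plugin_bias (y : R) :
  `|Ex p s (fun l => `|(cnt l)%:R - y|) - `|x - y| | <= Num.sqrt x.
Proof.
rewrite -[X in _ - X](Ex_cst p s) -ExB (le_trans (ler_norm_Ex _ _ _)) //.
apply: le_trans (Ex_count_absdev p i s); apply: ler_Ex => l _.
apply: (le_trans (ler_dist_dist _ _)).
by rewrite opprB addrA subrK.
Qed.

End Tails.

Section Single.
Variables (R : realType) (m s : nat).
Hypothesis m_gt1 : (1 < m)%N.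
Hypothesis s_ge : (2 * m <= s)%N.

(** All scales are in expected numbers of occurrences. A letter is light below
    [threshold], both for the reference mass and for the first half of the
    sample; the polynomial approximates on [[0, width]], and its estimator is
    evaluated only up to [cap]. The successive factors leave room for the
    fluctuations of the occurrence numbers. *)
Definition threshold : R := 40 * m%:R.
Definition width : R := 4 * threshold.
Definition cap : R := 8 * width.

Definition poly_est (y : R) (N : nat) : R :=
  width * abs_est m (y / width) (s%:R / width) s N.

Definition light_est (y : R) (N : nat) : R :=
  if N%:R <= cap then poly_est y N else `|N%:R - y|.

Definition diff_est (y : R) (N1 N2 : nat) : R :=
  if (y <= threshold) && (N1%:R <= threshold) then light_est y N2 else `|N2%:R - y|.

(* At least [10 * 2 ^ 10], the constant left by completing the square in
   [poly_est_bias]. *)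
Definition bias_cst : R := 2 ^+ 14.

(* [67 = 4 * 16 + 3] is the base of [cheb_est_bound] at [cap]. *)
Definition poly_sup : R := width * (m%:R * 67 ^+ m).

Let m_gt0 : 0 < m%:R :> R. Proof. by rewrite ltr0n ltnW. Qed.
Let m_ge2 : 2 <= m%:R :> R. Proof. by rewrite ler_nat. Qed.
Let wid_gt0 : 0 < width. Proof. by rewrite /width /threshold /threshold !mulr_gt0. Qed.
Let wid_neq0 : width != 0. Proof. by rewrite gt_eqF. Qed.
Let sR : 2 * m%:R <= s%:R :> R. Proof. by rewrite -natrM ler_nat. Qed.
Let ms : (m < s)%N.
Proof. by apply: leq_trans s_ge; rewrite mul2n -addnn -addn1 leq_add2l ltnW. Qed.

Lemma ratio_le (N : nat) : s%:R / width * (N%:R / (s%:R - m%:R)) <= 2 * N%:R / width.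
Proof.
have d0 : 0 < s%:R - m%:R :> R by rewrite subr_gt0 ltr_nat.
have -> : s%:R / width * (N%:R / (s%:R - m%:R)) =
    s%:R / (s%:R - m%:R) * (N%:R / width) by ring.
rewrite -[X in _ <= X]mulrA ler_wpM2r ?divr_ge0 ?(ltW wid_gt0) // ler_pdivrMr //.
by move: sR; lra.
Qed.

Lemma poly_est_bound (y : R) N : 0 <= y <= width ->
  `|poly_est y N| <= width * (m%:R * (8 * (N%:R / width) + 3) ^+ m).
Proof.
move=> /andP[y0 yw]; rewrite normrM gtr0_norm // ler_pM2l //.
have h0 : 0 <= 2 * N%:R / width by rewrite divr_ge0 ?mulr_ge0 // ltW.
have := abs_est_bound m_gt1 _ _ h0 ms (ratio_le N).
rewrite (_ : 4 * (2 * N%:R / width) = 8 * (N%:R / width)); last by ring.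
apply; last by rewrite divr_ge0 // ltW.
by rewrite divr_ge0 ?(ltW wid_gt0) //= ler_pdivrMr // mul1r.
Qed.

Lemma poly_est_le (y : R) N : 0 <= y <= width -> N%:R <= cap -> `|poly_est y N| <= poly_sup.
Proof.
move=> yw Nc; apply: (le_trans (poly_est_bound N yw)).
rewrite /poly_sup ler_pM2l // ler_pM2l // lerXn2r ?nnegrE //.
  by rewrite addr_ge0 // mulr_ge0 // divr_ge0 // ltW.
have : N%:R / width <= 8 by rewrite ler_pdivrMr // /width; move: Nc; rewrite /cap /width /threshold; lra.
by lra.
Qed.

Lemma poly_est_exp (y : R) N : 0 <= y <= width ->
  `|poly_est y N| <= width * (m%:R * expR (2 * m%:R + N%:R / 2)).
Proof.
move=> yw; apply: (le_trans (poly_est_bound N yw)).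
rewrite ler_pM2l // ler_pM2l //.
have -> : 2 * m%:R + N%:R / 2 = m%:R * (2 + N%:R / (2 * m%:R)) :> R.
  by field; rewrite gt_eqF.
rewrite expRM_natl lerXn2r ?nnegrE ?expR_ge0 //.
  by rewrite addr_ge0 // mulr_ge0 // divr_ge0 // ltW.
apply: le_trans (expR_ge1Dx _).
have : 8 * (N%:R / width) <= N%:R / (2 * m%:R).
  rewrite /width /threshold (_ : 8 * _ = N%:R / (20 * m%:R)); last by field; rewrite gt_eqF.
  rewrite ler_wpM2l // lef_pV2 ?posrE ?mulr_gt0 //; move: m_ge2; lra.
by lra.
Qed.

(** The factor 40 in [threshold] is chosen for this inequality: the tails must
    beat the exponential size of the polynomial estimator. *)
Lemma exp_dominates : m%:R * (poly_sup + 40) * expR (- (20 * m%:R)) <= 1.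
Proof.
rewrite expRN ler_pdivrMr ?expR_gt0 // mul1r.
have -> : 20 * m%:R = m%:R * 20 :> R by rewrite mulrC.
rewrite expRM_natl.
have e20 : 2 ^+ 20 <= expR 20 :> R.
  rewrite -[X in expR X]mulr1 expRM_natl lerXn2r ?nnegrE ?expR_ge0 //; exact: expR1_ge2.
apply: (@le_trans _ _ ((2 ^+ 20) ^+ m)); last first.
  by rewrite lerXn2r ?nnegrE ?expR_ge0 ?exprn_ge0.
have m2 := natr_le_exp2 R m.
have z7 := exp67_le R m; set z : R := 2 ^+ m in m2 z7.
have z2 : 4 <= z.
  by apply: (@le_trans _ _ (2 ^+ 2)); [rewrite expr2; lra | rewrite ler_weXn2l // ler1n].
rewrite exprAC -/z /poly_sup /width /threshold.
have m1 : 0 <= m%:R :> R by rewrite ler0n.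
have z0 : 0 <= z by lra.
have p0 : 0 <= 67 ^+ m :> R by rewrite exprn_ge0.
have a1 : m%:R * m%:R * m%:R <= z ^+ 3.
  by rewrite !exprS expr0 mulr1 mulrA !ler_pM ?mulr_ge0.
have a2 : m%:R * m%:R * m%:R * 67 ^+ m <= z ^+ 10.
  by rewrite (exprD z 3 7) ler_pM ?mulr_ge0.
have a3 : z <= z ^+ 10 by rewrite -[X in X <= _]expr1 ler_weXn2l //; lra.
have a4 : 200 <= z ^+ 10.
  apply: (@le_trans _ _ (4 ^+ 10)); last by rewrite lerXn2r ?nnegrE.
  by rewrite -natrX ler_nat.
have a5 : z ^+ 20 = z ^+ 10 * z ^+ 10 by rewrite -exprD.
have : 200 * z ^+ 10 <= z ^+ 10 * z ^+ 10 by rewrite ler_wpM2r // exprn_ge0.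
have : m%:R * (4 * (40 * m%:R) * (m%:R * 67 ^+ m) + 40) =
  160 * (m%:R * m%:R * m%:R * 67 ^+ m) + 40 * m%:R :> R by ring.
by lra.
Qed.

Lemma threshold_ge1 : 1 <= threshold.
Proof. by rewrite /threshold; move: m_ge2; lra. Qed.

Lemma threshold_le_sup : threshold <= poly_sup.
Proof.
rewrite /poly_sup /width /threshold.
have h : 1 <= 67 ^+ m :> R by rewrite exprn_ege1 // ler1n.
have : 1 <= m%:R * 67 ^+ m :> R by rewrite mulr_ege1 // ler1n ltnW.
by move: m_ge2; nra.
Qed.

Lemma tiny_le : (poly_sup + 40) * expR (- (20 * m%:R)) <= m%:R^-1.
Proof.
have m0 : 0 < m%:R :> R by move: m_ge2; lra.
rewrite -(ler_pM2l m0) mulfV ?gt_eqF // mulrA; exact: exp_dominates.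
Qed.

(** The next two lemmas make the plug-in bias linear, hence summable, when
    either mass is not far below [threshold]. *)
Lemma sqrt_le_plugin (x : R) : threshold <= 9 * x -> Num.sqrt x <= 3 * x / Num.sqrt threshold.
Proof.
have c0 : 0 < threshold := lt_le_trans ltr01 threshold_ge1.
move=> cx; have x0 : 0 <= x by lra.
rewrite ler_pdivlMr ?sqrtr_gt0 // -{2}(sqr_sqrtr x0) expr2 mulrA mulrC.
rewrite ler_wpM2r ?sqrtr_ge0 // -(@ler_sqr _ (Num.sqrt threshold)) ?nnegrE ?mulr_ge0 ?sqrtr_ge0 //.
by rewrite exprMn !sqr_sqrtr //; lra.
Qed.

Lemma sqrt_le_heavy (x y : R) : 0 <= x -> threshold <= y ->
  Num.sqrt x <= 3 * (x + y) / Num.sqrt threshold.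
Proof.
move=> x0 cy.
have c0 : 0 < threshold := lt_le_trans ltr01 threshold_ge1.
have sc : 0 < Num.sqrt threshold by rewrite sqrtr_gt0.
rewrite ler_pdivlMr //.
have : 0 <= (Num.sqrt x - Num.sqrt threshold) ^+ 2 by rewrite sqr_ge0.
have e1 := sqr_sqrtr x0; have e2 := sqr_sqrtr (ltW c0).
rewrite sqrrB e1 e2; lra.
Qed.

Section Bias.
Variables (T : finType) (p : distr R T) (i : T).
Local Notation x := (s%:R * p i).
Local Notation cnt := (count_mem i).

Let x0 : 0 <= x. Proof. by rewrite mulr_ge0 ?pmf_ge0. Qed.

(** Beyond [cap] the polynomial estimator is at most [expR (N / 2)] up to a
    factor depending on [m], while [N] exceeds [cap] with exponentially small
    probability; multiplying by [expR ((N - cap) / 2) >= 1] reduces both facts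
    to the exponential moment of [N]. *)
Lemma truncation_bias (y : R) : 0 <= y <= threshold -> x <= width ->
  `|Ex p s (fun l => light_est y (cnt l)) - Ex p s (fun l => poly_est y (cnt l))| <=
  (poly_sup + 2) * expR (- (20 * m%:R)).
Proof.
move=> /andP[y0 yc] xw.
have yw : 0 <= y <= width.
  by rewrite y0 /=; apply: (le_trans yc); rewrite /width /threshold; move: m_ge2; lra.
rewrite -ExB (le_trans (ler_norm_Ex _ _ _)) //.
set A := (width * (m%:R * expR (2 * m%:R)) + 2) * expR (- (cap / 2)).
have A0 : 0 <= width * (m%:R * expR (2 * m%:R)) + 2.
  by rewrite addr_ge0 // !mulr_ge0 ?expR_ge0 // ltW.
apply: (@le_trans _ _ (A * Ex p s (fun l => expR (cnt l)%:R))).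
  rewrite -ExZ; apply: ler_Ex => l _; rewrite /light_est.
  case: ifPn => [_|]; first by rewrite subrr normr0 !mulr_ge0 ?expR_ge0.
  rewrite -ltNge => h; set N := cnt l in h *.
  have N1 : `|N%:R - y| <= 2 * expR (N%:R / 2).
    rewrite ger0_norm; last first.
      by rewrite subr_ge0 (le_trans yc) // (le_trans _ (ltW h)) // /cap /width /threshold; move: m_ge2; lra.
    by have := expR_ge1Dx (N%:R / 2 : R); lra.
  have N2 := poly_est_exp N yw; rewrite expRD in N2.
  apply: (le_trans (ler_normB _ _)).
  apply: (@le_trans _ _ ((width * (m%:R * expR (2 * m%:R)) + 2) * expR (N%:R / 2))).
    by rewrite normr_id; lra.
  rewrite /A -mulrA ler_wpM2l // -expRD ler_expR; lra.
apply: (@le_trans _ _ (A * expR (3 * width))).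
  rewrite ler_wpM2l ?mulr_ge0 ?expR_ge0 //.
  by apply: (le_trans (Ex_count_expR _ _ _)); rewrite ler_expR; lra.
rewrite /A -mulrA -expRD ler_pM ?expR_ge0 //; last first.
  by rewrite ler_expR /cap /width /threshold; move: m_ge2; lra.
rewrite lerD2r /poly_sup ler_pM2l // ler_pM2l //.
rewrite mulrC expRM_natl lerXn2r ?nnegrE ?expR_ge0 //.
have -> : 2 = 2%:R * 1 :> R by rewrite mulr1.
rewrite expRM_natl; apply: (@le_trans _ _ (4 ^+ 2)).
  by rewrite lerXn2r ?nnegrE ?expR_ge0 // expR1_le4.
by rewrite -natrX ler_nat.
Qed.

(** With [x = width * t ^+ 2], the term [sqrt (x / m)] of the approximation
    error is linear in [t], and completing a square in [d * m * t] exchanges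
    it for [d * x / 16] plus a constant. *)
Lemma poly_est_bias (y d : R) : 0 <= y <= width -> x <= width -> 0 < d ->
  `|Ex p s (fun l => poly_est y (cnt l)) - `|x - y| | <=
  d * x / 16 + bias_cst / (d * m%:R) + bias_cst / m%:R.
Proof.
move=> /andP[y0 yw] xw d0.
have cx : s%:R / width * p i = x / width by rewrite mulrAC.
have v01 : 0 <= s%:R / width * p i <= 1.
  by rewrite cx divr_ge0 ?(ltW wid_gt0) //= ler_pdivrMr // mul1r.
have := Ex_abs_est m_gt1 (y / width) v01 (ltnW ms).
rewrite ExZ cx -mulrBl normrM (ger0_norm (_ : 0 <= width^-1)) ?invr_ge0 ?(ltW wid_gt0) //.
set E := Ex _ _ _; set t := Num.sqrt _ => H.
have -> : width * E - `|x - y| = width * (E - `|x - y| / width) by field.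
rewrite normrM gtr0_norm //.
have t0 : 0 <= t by rewrite sqrtr_ge0.
have xt : x = 160 * m%:R * t ^+ 2.
  by rewrite /t sqr_sqrtr ?divr_ge0 ?(ltW wid_gt0) // /width /threshold; field; rewrite gt_eqF.
have al := ang_le R m_gt1; have a0 := ang_gt0 R m_gt1.
apply: (@le_trans _ _ (width * (4 / m%:R * t + (4 / m%:R) ^+ 2 / 4))).
  rewrite ler_pM2l // (le_trans H) // lerD ?(ler_wpM2r t0 al) //.
  by rewrite ler_pM2r ?invr_gt0 // lerXn2r // nnegrE ?(ltW a0) // divr_ge0.
have -> : width * (4 / m%:R * t + (4 / m%:R) ^+ 2 / 4) = 640 * t + 640 / m%:R.
  by rewrite /width /threshold; field; rewrite gt_eqF.
have e10 : 10 * 2 ^+ 10 <= bias_cst.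
  by rewrite /bias_cst (exprD _ 4 10) ler_pM2r ?exprn_gt0 // !exprS expr0; lra.
apply: lerD; last first.
  rewrite ler_pM2r ?invr_gt0 // (le_trans _ e10) // !exprS expr0; lra.
apply: (@le_trans _ _ (d * x / 16 + 10 * 2 ^+ 10 / (d * m%:R))); last first.
  by rewrite lerD2l ler_pM2r // invr_gt0 mulr_gt0.
rewrite xt.
have dm : 0 < d * m%:R by rewrite mulr_gt0.
rewrite -(ler_pM2r dm).
have -> : (d * (160 * m%:R * t ^+ 2) / 16 + 10 * 2 ^+ 10 / (d * m%:R)) * (d * m%:R) =
  10 * (d * m%:R * t) ^+ 2 + 10 * 2 ^+ 10.
  by field; rewrite !gt_eqF.
have : 0 <= (d * m%:R * t - 2 ^+ 5) ^+ 2 by rewrite sqr_ge0.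
by rewrite sqrrB (exprD _ 5 5) !exprS expr0; lra.
Qed.

Lemma light_est_far (y : R) : 0 <= y <= threshold -> width <= x ->
  `|Ex p s (fun l => light_est y (cnt l)) - `|x - y| | <= poly_sup + 4 * x.
Proof.
move=> /andP[y0 yc] xw.
have cw : threshold <= width by rewrite /width /threshold; move: m_ge2; lra.
have yw : 0 <= y <= width by rewrite y0 (le_trans yc).
have S0 : 0 <= poly_sup by rewrite /poly_sup !mulr_ge0 ?exprn_ge0 // ltW.
have yx : y <= x by rewrite (le_trans yc) // (le_trans cw).
apply: (le_trans (ler_normB _ _)).
have e1 : `|Ex p s (fun l => light_est y (cnt l))| <= poly_sup + (x + y).
  apply: (le_trans (ler_norm_Ex _ _ _)).
  rewrite -(Ex_count p i s) -[X in X + _](Ex_cst p s) -[X in _ <= _ + (_ + X)](Ex_cst p s) -!ExD.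
  apply: ler_Ex => l _; rewrite /light_est; case: ifPn => h.
    by rewrite (le_trans (poly_est_le yw h)) // lerDl addr_ge0.
  rewrite normr_id (le_trans (ler_normB _ _)) // ger0_norm // (ger0_norm y0).
  by rewrite lerDr.
rewrite normr_id (ger0_norm (_ : 0 <= x - y)) ?subr_ge0 //.
by lra.
Qed.


(** The mean is a mixture, with the probability that the first half calls the
    letter light, of the means of [light_est] and of the plug-in estimator. When
    [x] lies in the range where one of them is bad, the tails make its weight
    negligible: the polynomial is bad above [width = 4 * threshold], the plug-in
    below [threshold / 9]. *)
Lemma diff_est_bias (y d : R) : 0 <= y -> 0 < d <= 1 ->
  `|Ex p (s + s) (fun l => diff_est y (cnt (take s l)) (cnt (drop s l))) - `|x - y| | <=
  3 * (x + y) / Num.sqrt threshold + d * x / 16 + 3 * (bias_cst / (d * m%:R)).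
Proof.
move=> y0 /andP[d0 d1].
have m0 : 0 < m%:R :> R by move: m_ge2; lra.
have x_ge0 : 0 <= x := x0.
have c0 : 0 < threshold := lt_le_trans ltr01 threshold_ge1.
have sc : 0 < Num.sqrt threshold by rewrite sqrtr_gt0.
have inv0 : 0 <= m%:R^-1 :> R by rewrite invr_ge0.
have dx0 : 0 <= d * x / 16 by rewrite divr_ge0 // mulr_ge0 // ltW.
have poly (y1 : R) : 0 <= y1 <= width -> x <= width ->
    `|Ex p s (fun l => poly_est y1 (cnt l)) - `|x - y1| | <=
    d * x / 16 + bias_cst / (d * m%:R) + bias_cst / m%:R.
  by move=> yw xw; apply: poly_est_bias.
have : bias_cst / m%:R <= bias_cst / (d * m%:R).
  rewrite ler_wpM2l ?exprn_ge0 // lef_pV2 ?posrE ?mulr_gt0 // ger_pMl //.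
have : 2 * m%:R^-1 <= bias_cst / m%:R.
  by rewrite ler_wpM2r // /bias_cst exprS ler_peMr // exprn_ege1 // ler1n.
move: poly; move: (bias_cst / (d * _)) => B.
move: (bias_cst / _) => Bm poly im BmB.
have B0 : 0 <= B by lra.
rewrite (Ex_halves p s (fun l1 l2 => diff_est y (cnt l1) (cnt l2))).
set dist := `|x - y|.
set E0 := Ex p s (fun l => `|(cnt l)%:R - y|).
have pl : `|E0 - dist| <= Num.sqrt x := plugin_bias p i s y.
have [yc|yc] := leP y threshold; last first.
  rewrite (@eq_Ex _ _ _ _ _ (fun=> E0)); last first.
    by move=> l1 _; apply: eq_Ex => l2 _; rewrite /diff_est leNgt yc.
  rewrite Ex_cst (le_trans pl) // -addrA (le_trans (sqrt_le_heavy x0 (ltW yc))) //.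
  by rewrite lerDl addr_ge0 // mulr_ge0.
set S := Ex p s (fun l => light_est y (cnt l)).
set P := Ex p s (fun l => (((cnt l)%:R <= threshold)%R : nat)%:R).
have P0 : 0 <= P by apply: Ex_ge0 => l _.
have P1 : 1 - P = Ex p s (fun l => (~~ ((cnt l)%:R <= threshold)%R : nat)%:R).
  rewrite -[X in X - _](Ex_cst p s) -ExB; apply: eq_Ex => l _.
  by case: (_ <= _); rewrite /= ?subrr ?subr0.
have P1' : 0 <= 1 - P by rewrite P1; apply: Ex_ge0 => l _.
have SE : S = Ex p s (fun l => light_est y (cnt l)) by [].
have PE : P = Ex p s (fun l => (((cnt l)%:R <= threshold)%R : nat)%:R) by [].
have distE : dist = `|x - y| by [].
rewrite (@eq_Ex _ _ _ _ _ (fun l1 => (S - E0) * (((cnt l1)%:R <= threshold)%R : nat)%:R + E0)); last first.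
  move=> l1 _; case h : ((cnt l1)%:R <= threshold); rewrite /= ?mulr1 ?mulr0 ?subrK ?add0r.
    by apply: eq_Ex => l2 _; rewrite /diff_est yc h.
  by apply: eq_Ex => l2 _; rewrite /diff_est yc h.
rewrite ExD ExZ Ex_cst -/P.
clearbody S P E0 dist.
have P_le1 : P <= 1 by rewrite -subr_ge0.
have Q_le1 : 1 - P <= 1 by rewrite gerBl.
have -> : (S - E0) * P + E0 - dist = P * (S - dist) + (1 - P) * (E0 - dist) by ring.
apply: (le_trans (ler_normD _ _)); rewrite !normrM (ger0_norm P0) (ger0_norm P1').
have tiny := tiny_le.
have e0 := expR_gt0 (- (20 * m%:R) : R).
have yterm : 0 <= y / Num.sqrt threshold by rewrite divr_ge0 // ltW.
have xterm : 0 <= x / Num.sqrt threshold by rewrite divr_ge0 // ltW.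
have split3 : 3 * (x + y) / Num.sqrt threshold = 3 * (x / Num.sqrt threshold) + 3 * (y / Num.sqrt threshold) by ring.
have far : (1 - P) * `|E0 - dist| <= 3 * (x / Num.sqrt threshold) + m%:R^-1.
  have [cx|cx] := leP threshold (9 * x).
    apply: (@le_trans _ _ (Num.sqrt x)).
      exact: le_trans (ler_piMl (normr_ge0 _) Q_le1) pl.
    by have := sqrt_le_plugin cx; rewrite -mulrA; lra.
  have s1 : Num.sqrt x <= threshold.
    have := sqr_sqrtr x0; have := threshold_ge1; have : 0 <= (Num.sqrt x - 1) ^+ 2 := sqr_ge0 _.
    by rewrite sqrrB => ? ? ?; lra.
  have s2 : 1 - P <= expR (- (20 * m%:R)).
    rewrite P1 (le_trans (upper_tail _ _ _ _)) // ler_expR.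
    by move: cx; rewrite /threshold; move: m_ge2; lra.
  have : (1 - P) * `|E0 - dist| <= expR (- (20 * m%:R)) * threshold.
    by rewrite ler_pM // (le_trans pl).
  have : expR (- (20 * m%:R)) * threshold <= (poly_sup + 40) * expR (- (20 * m%:R)).
    by rewrite mulrC ler_pM2r //; have := threshold_le_sup; lra.
  by lra.
have near : P * `|S - dist| <= d * x / 16 + B + Bm + m%:R^-1.
  have [xw|xw] := leP x width.
    have yw : 0 <= y <= width.
      by rewrite y0 /=; apply: (le_trans yc); rewrite /width /threshold; move: m_ge2; lra.
    have h1 := poly y yw xw.
    have h2 := truncation_bias (y := y) _ xw.
    have {}h2 := h2 (introT andP (conj y0 yc)).
    rewrite -SE in h2; rewrite -distE in h1.
    apply: (@le_trans _ _ `|S - dist|); first exact: ler_piMl (normr_ge0 _) P_le1.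
    have := ler_distD (Ex p s (fun l => poly_est y (cnt l))) S dist.
    have : (poly_sup + 2) * expR (- (20 * m%:R)) <= (poly_sup + 40) * expR (- (20 * m%:R)).
      by rewrite ler_pM2r //; lra.
    lra.
  have h1 := light_est_far (y := y) _ (ltW xw).
  have {}h1 := h1 (introT andP (conj y0 yc)); rewrite -SE -distE in h1.
  have S0 : 0 <= poly_sup by rewrite (le_trans (ltW c0)) // threshold_le_sup.
  have PB : P <= expR (- (x / 8)) * expR (- (x / 8)).
    rewrite PE (le_trans (lower_tail _ _ _ _)) // -expRD ler_expR.
    by move: xw; rewrite /width /threshold; lra.
  have PC : expR (- (x / 8)) <= expR (- (20 * m%:R)).
    by rewrite ler_expR; move: xw; rewrite /width /threshold; lra.
  have X8 : expR (- (x / 8)) * x <= 8.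
    have := expR_ge1Dx (x / 8); rewrite expRN => h.
    rewrite mulrC ler_pdivrMr ?expR_gt0 //; lra.
  have X1 : expR (- (x / 8)) <= 1 by rewrite expRN invf_le1 ?expR_gt0 //; have := expR_ge1Dx (x / 8); lra.
  have : P * `|S - dist| <= expR (- (x / 8)) * expR (- (x / 8)) * (poly_sup + 4 * x).
    by rewrite ler_pM.
  have : expR (- (x / 8)) * expR (- (x / 8)) * (poly_sup + 4 * x) <=
      expR (- (20 * m%:R)) * (poly_sup + 40).
    rewrite -mulrA ler_pM ?expR_ge0 //.
      by rewrite mulr_ge0 ?expR_ge0 // addr_ge0 // mulr_ge0.
    have : expR (- (x / 8)) * poly_sup <= poly_sup by rewrite ler_piMl.
    by rewrite mulrDr mulrCA; lra.
  by lra.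
by rewrite split3; lra.
Qed.

End Bias.

(** The estimator differs from the 1-Lipschitz plug-in by a bounded function. *)
Lemma diff_est_lipschitz (y : R) (a b a' b' : nat) : 0 <= y ->
  `|diff_est y a b - diff_est y a' b'| <=
  2 * (poly_sup + threshold + cap) + `|b%:R - b'%:R|.
Proof.
move=> y0.
have S0 : 0 <= poly_sup.
  by rewrite (le_trans _ threshold_le_sup) // (le_trans _ threshold_ge1).
have k0 : 0 <= cap by rewrite /cap /width /threshold !mulr_ge0.
have c0 : 0 <= threshold by rewrite (le_trans _ threshold_ge1).
have H (a1 b1 : nat) : `|diff_est y a1 b1 - `|b1%:R - y| | <= poly_sup + threshold + cap.
  rewrite /diff_est; case: ifPn => [/andP[yc _]|_]; last by rewrite subrr normr0 !addr_ge0.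
  rewrite /light_est; case: ifPn => [bc|_]; last by rewrite subrr normr0 !addr_ge0.
  have yw : 0 <= y <= width.
    by rewrite y0 /=; apply: (le_trans yc); rewrite /width /threshold; move: m_ge2; lra.
  rewrite (le_trans (ler_normB _ _)) // -addrA lerD ?poly_est_le //.
  rewrite normr_id (le_trans (ler_normB _ _)) // addrC lerD ?ger0_norm //.
have h1 := H a b; have h2 := H a' b'.
have h3 : `| `|b%:R - y| - `|b'%:R - y| | <= `|b%:R - b'%:R|.
  by rewrite (le_trans (ler_dist_dist _ _)) // opprB addrA subrK.
have -> : diff_est y a b - diff_est y a' b' = (diff_est y a b - `|b%:R - y|)
   - (diff_est y a' b' - `|b'%:R - y|) + (`|b%:R - y| - `|b'%:R - y|) by ring.
apply: (le_trans (ler_normD _ _)).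
apply: (le_trans (lerD (ler_normB _ _) h3)); lra.
Qed.

End Single.

(** * The total variation distance and the tester *)

(** The supremum is attained at the set where [p] dominates [q]. *)
Lemma dTV_half_sum (R : realType) (T : finType) (p q : distr R T) :
  2 * dTV p q = \sum_x `|p x - q x|.
Proof.
have probB (S : {set T}) : prob p S - prob q S = \sum_(x in S) (p x - q x).
  by rewrite /prob big_split /= sumrN.
have sum0 : \sum_x (p x - q x) = 0.
  by rewrite big_split /= sumrN !pmf_sum1 subrr.
have two (S : {set T}) : 2 * (prob p S - prob q S) =
    \sum_(x in S) (p x - q x) + \sum_(x in ~: S) - (p x - q x).
  rewrite probB sumrN (_ : \sum_(x in ~: S) _ = - \sum_(x in S) (p x - q x)).
    by rewrite opprK; ring.
  rewrite (eq_bigl (fun x => x \notin S)); last by move=> x; rewrite inE.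
  by apply/eqP; rewrite -addr_eq0 addrC; move: sum0; rewrite (bigID (mem S)) /= => ->.
pose S0 : {set T} := [set x | q x <= p x]%SET.
have top : 2 * (prob p S0 - prob q S0) = \sum_x `|p x - q x|.
  rewrite two [RHS](bigID (mem S0)) /=; congr (_ + _).
    by apply: eq_bigr => x; rewrite inE => h; rewrite ger0_norm // subr_ge0.
  apply: eq_big => x; rewrite !inE // -ltNge => h.
  by rewrite ltr0_norm // subr_lt0.
have ub (S : {set T}) : prob p S - prob q S <= prob p S0 - prob q S0.
  rewrite -(@ler_pM2l _ 2) // top two [leRHS](bigID (mem S)) /= lerD //.
    by apply: ler_sum => x _; apply: ler_norm.
  rewrite [leLHS](eq_bigl (fun x => x \notin S)); last by move=> x; rewrite inE.
  by apply: ler_sum => x _; rewrite -normrN ler_norm.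
rewrite -top; congr (2 * _); rewrite /dTV; apply/eqP; rewrite eq_le; apply/andP; split.
  apply: ge_sup; first by exists (prob p S0 - prob q S0); exists S0.
  by move=> _ [S _ <-].
apply: ub_le_sup; last by exists S0.
by exists (prob p S0 - prob q S0) => _ [S _ <-].
Qed.

(** Replacing one sample alters the occurrence number of [i] only through that
    sample, with [b = 0] when the sample falls outside the part considered. *)
Lemma count_take_change (T : eqType) (i : T) (s : nat) (u v : seq T) :
  exists c b, forall z, count_mem i (take s (u ++ z :: v)) = (c + b * (z == i))%N.
Proof.
have [su|us] := leqP s (size u).
  exists (count_mem i (take s u)), 0%N => z.
  by rewrite takel_cat // mul0n addn0.
exists (count_mem i u + count_mem i (take (s - size u).-1 v))%N, 1%N => z.
rewrite take_cat ltnNge (ltnW us) /= count_cat.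
by rewrite -(ltn_predK (_ : 0 < s - size u)%N) ?subn_gt0 //= mul1n addnAC addnA addnAC.
Qed.

Lemma count_drop_change (T : eqType) (i : T) (s : nat) (u v : seq T) :
  exists c b, (b <= 1)%N /\
    forall z, count_mem i (drop s (u ++ z :: v)) = (c + b * (z == i))%N.
Proof.
have [su|us] := leqP s (size u).
  exists (count_mem i (drop s u) + count_mem i v)%N, 1%N; split=> // z.
  have -> : drop s (u ++ z :: v) = drop s u ++ z :: v.
    by rewrite drop_cat; case: ltngtP su => // -> _; rewrite subnn drop0 drop_size.
  by rewrite count_cat /= mul1n addnCA addnC.
exists (count_mem i (drop (s - size u).-1 v)), 0%N; split=> // z.
rewrite drop_cat ltnNge (ltnW us) /= mul0n addn0.
by rewrite -[in LHS](ltn_predK (_ : 0 < s - size u)%N) ?subn_gt0.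
Qed.

Definition decide (R : realType) (b : bool) : {ffun bool -> R} :=
  [ffun c => (c == b)%:R].

Lemma decide_ge0 (R : realType) b x : 0 <= decide R b x.
Proof. by rewrite ffunE. Qed.

Lemma decide_sum1 (R : realType) b : \sum_x decide R b x = 1.
Proof. by rewrite big_bool /= !ffunE; case: b; rewrite /= ?addr0 ?add0r. Qed.

Definition answer (R : realType) (b : bool) : distr R bool :=
  Distr (decide_ge0 R b) (decide_sum1 R b).

Section Tester.
Variables (R : realType) (n m s : nat) (q : distr R 'I_n).
Hypothesis m_gt1 : (1 < m)%N.
Hypothesis s_ge : (2 * m <= s)%N.

Definition total_est (l : seq 'I_n) : R :=
  \sum_(i < n) diff_est m s (s%:R * q i) (count_mem i (take s l)) (count_mem i (drop s l)).

Definition sensitivity : R := 2 * (2 * (poly_sup R m + threshold R m + cap R m) + 1).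

Let y_ge0 i : 0 <= s%:R * q i. Proof. by rewrite mulr_ge0 ?pmf_ge0. Qed.

(** Only the two letters exchanged have new occurrence numbers. *)
Lemma total_est_bounded_diff u x y v :
  `|total_est (u ++ x :: v) - total_est (u ++ y :: v)| <= sensitivity.
Proof.
set e := 2 * (poly_sup R m + threshold R m + cap R m) + 1.
have e0 : 0 <= e.
  have /(_ 0 0%N 0%N 0%N 0%N (lexx 0)) := @diff_est_lipschitz R m s m_gt1 s_ge.
  by rewrite !subrr normr0 /e; lra.
have eE : e = 2 * (poly_sup R m + threshold R m + cap R m) + 1 by [].
rewrite /sensitivity -eE; clearbody e.
rewrite -sumrB (le_trans (ler_norm_sum _ _ _)) //.
apply: (@le_trans _ _ (\sum_(i < n) ((x == i)%:R * e + (y == i)%:R * e))).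
  apply: ler_sum => i _.
  have [c1 [b1 H1]] := count_take_change i s u v.
  have [c2 [b2 [b2le H2]]] := count_drop_change i s u v.
  rewrite !H1 !H2.
  case: (eqVneq x i) => [xi|xi]; case: (eqVneq y i) => [yi|yi] /=;
    rewrite ?muln1 ?muln0 ?addn0 ?mul1r ?mul0r ?addr0 ?add0r ?subrr ?normr0 ?addr_ge0 //.
  - apply: (le_trans (diff_est_lipschitz m_gt1 s_ge _ _ _ _ (y_ge0 i))).
    rewrite (_ : (c2 + b2)%:R - c2%:R = b2%:R); last by rewrite natrD; ring.
    by rewrite normr_nat eE lerD2l lern1.
  - apply: (le_trans (diff_est_lipschitz m_gt1 s_ge _ _ _ _ (y_ge0 i))).
    rewrite (_ : c2%:R - (c2 + b2)%:R = - b2%:R); last by rewrite natrD; ring.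
    by rewrite normrN normr_nat eE lerD2l lern1.
rewrite big_split /= -!mulr_suml.
have one (z : 'I_n) : \sum_(i < n) (z == i)%:R = 1 :> R.
  by rewrite (bigD1 z) //= eqxx big1 ?addr0 // => i; rewrite eq_sym => /negPf ->.
by rewrite !one mul1r; lra.
Qed.

(** The three parts of the bias of a letter sum to at most [1/4], [1/16] and
    [3/16] of [d * s]. *)
Lemma total_est_bias (p : distr R 'I_n) (d : R) : 0 < d <= 1 ->
  24 <= d * Num.sqrt (threshold R m) ->
  16 * bias_cst R * n%:R <= d ^+ 2 * m%:R * s%:R ->
  `|Ex p (s + s) total_est - 2 * s%:R * dTV p q| <= s%:R * d / 2.
Proof.
move=> d01 hthr hs; have /andP[d0 d1] := d01.
have m0 : 0 < m%:R :> R by rewrite ltr0n ltnW.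
have s0 : 0 <= s%:R :> R by [].
have sq : 0 < Num.sqrt (threshold R m).
  by rewrite sqrtr_gt0 (lt_le_trans ltr01) // threshold_ge1.
have -> : 2 * s%:R * dTV p q = \sum_(i < n) `|s%:R * p i - s%:R * q i|.
  rewrite mulrAC dTV_half_sum mulr_suml; apply: eq_bigr => i _.
  by rewrite -mulrBr normrM ger0_norm // mulrC.
rewrite /total_est Ex_sum -sumrB (le_trans (ler_norm_sum _ _ _)) //.
have [B BE] : exists B, B = bias_cst R / (d * m%:R) by eexists.
apply: (@le_trans _ _ (\sum_(i < n) ((3 / Num.sqrt (threshold R m) * s%:R + d * s%:R / 16) * p i +
   3 / Num.sqrt (threshold R m) * s%:R * q i + 3 * B))).
  apply: ler_sum => i _.
  apply: (le_trans (diff_est_bias m_gt1 s_ge p i (y_ge0 i) d01)).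
  rewrite -BE le_eqVlt; apply/orP; left; apply/eqP; ring.
rewrite !big_split /= -!mulr_sumr !pmf_sum1 sumr_const card_ord !mulr1.
rewrite -(mulr_natr B n).
have h1 : 3 / Num.sqrt (threshold R m) * s%:R <= d / 8 * s%:R.
  by rewrite ler_wpM2r // ler_pdivrMr //; lra.
have h2 : 3 * B * n%:R <= 3 / 16 * (d * s%:R).
  rewrite BE -(ler_pM2r (mulr_gt0 d0 m0)).
  have -> : 3 * (bias_cst R / (d * m%:R)) * n%:R * (d * m%:R) = 3 / 16 * (16 * bias_cst R * n%:R).
    by field; rewrite !gt_eqF.
  have -> : 3 / 16 * (d * s%:R) * (d * m%:R) = 3 / 16 * (d ^+ 2 * m%:R * s%:R) by ring.
  by rewrite ler_wpM2l // divr_ge0.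
by lra.
Qed.

Lemma tester_correct (e d : R) : (0 < s)%N -> 0 < d <= 1 ->
  24 <= d * Num.sqrt (threshold R m) ->
  16 * bias_cst R * n%:R <= d ^+ 2 * m%:R * s%:R ->
  24 * sensitivity ^+ 2 <= s%:R * d ^+ 2 ->
  exists A : algorithm R 'I_n (s + s),
    forall D, distinguishes A D [set p | dTV p q <= e] [set p | e + d < dTV p q].
Proof.
move=> s_gt0 d01 hthr hs hsens; have /andP[d0 d1] := d01.
have s0 : 0 < s%:R :> R by rewrite ltr0n.
set th := s%:R * (2 * e + d).
exists (fun x => answer R (total_est x <= th)) => D.
have dev p : Ex p (s + s) (fun l => ((s%:R * d / 2 <= `|total_est l - Ex p (s + s) total_est|)%R : nat)%:R)
    <= 3^-1.
  have t0 : 0 < s%:R * d / 2 by rewrite divr_gt0 // mulr_gt0.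
  have V := @Ex_bounded_diff R _ p (s + s) total_est sensitivity
    (fun u x y v _ => total_est_bounded_diff u x y v).
  apply: (le_trans (chebyshev t0 V)).
  rewrite ler_pdivrMr ?exprn_gt0 //.
  have -> : (s + s)%:R * sensitivity ^+ 2 = s%:R / 12 * (24 * sensitivity ^+ 2) by rewrite natrD; field.
  have -> : 3^-1 * (s%:R * d / 2) ^+ 2 = s%:R / 12 * (s%:R * d ^+ 2) by field.
  by rewrite ler_wpM2l // divr_ge0 // ltW.
have good p b : (forall l, ~~ (s%:R * d / 2 <= `|total_est l - Ex p (s + s) total_est|) ->
    (total_est l <= th) = b) ->
    2 / 3 <= prob_answer (fun x : (s + s).-tuple 'I_n => answer R (total_est x <= th)) p b.
  move=> H; rewrite /prob_answer (Ex_tuple p (s + s) (fun l => answer R (total_est l <= th) b)).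
  apply: (@le_trans _ _ (Ex p (s + s) (fun l => 1 -
      ((s%:R * d / 2 <= `|total_est l - Ex p (s + s) total_est|)%R : nat)%:R))).
    by rewrite ExB Ex_cst; have := dev p; lra.
  apply: ler_Ex => l _; rewrite /= ffunE.
  have [h|h] := boolP (s%:R * d / 2 <= _); first by rewrite subrr.
  by rewrite (H l h) eqxx subr0.
split=> p _ /= hp; apply: good => l; rewrite -ltNge ltr_norml => /andP[l1 l2];
  have := total_est_bias p d01 hthr hs; rewrite ler_norml => /andP[b1 b2];
  rewrite /th.
- by have : s%:R * dTV p q <= s%:R * e; [rewrite ler_pM2l|lra].
- apply/negbTE; rewrite -ltNge.
  by have : s%:R * (e + d) < s%:R * dTV p q; [rewrite ltr_pM2l|lra].
Qed.

End Tester.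

(** * Choice of the parameters *)

(** [sensitivity] is polynomial in [m] times [67 ^+ m]. The exponent 40 fixes the
    relation [n >= 2 ^+ (40 * m)] between [m] and [n]. *)
Lemma sensitivity_le (R : realType) (m : nat) : (1 < m)%N ->
  24 * sensitivity R m ^+ 2 * m%:R <= 2 ^+ 18 * (2 ^+ m) ^+ 40.
Proof.
move=> m1.
have m2 := natr_le_exp2 R m.
have z7 := exp67_le R m; set z : R := 2 ^+ m in m2 z7 *.
have z2 : 2 <= z by rewrite (le_trans _ m2) // ler_nat.
have zp : 0 < z by lra.
have z0 := ltW zp.
have m0 : 0 <= m%:R :> R by [].
have a1 : m%:R * (m%:R * 67 ^+ m) <= z ^+ 9 by rewrite !(exprS z 8, exprS z 7) !ler_pM ?mulr_ge0 ?exprn_ge0.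
have a2 : z <= z ^+ 9 by rewrite -[X in X <= _]expr1 ler_weXn2l //; lra.
have z9 : 2 <= z ^+ 9 by lra.
have s1 : sensitivity R m <= 2 ^+ 13 * z ^+ 9.
  rewrite /sensitivity /poly_sup /cap /width /threshold.
  have -> : 4 * (40 * m%:R) * (m%:R * 67 ^+ m) = 160 * (m%:R * (m%:R * 67 ^+ m)) :> R by ring.
  have : 5924 * z ^+ 9 <= 2 ^+ 13 * z ^+ 9.
    by rewrite ler_pM2r ?exprn_gt0 // -natrX ler_nat.
  by lra.
have s0 : 0 <= sensitivity R m.
  rewrite /sensitivity /poly_sup /cap /width /threshold.
  by rewrite mulr_ge0 // addr_ge0 // mulr_ge0 // !addr_ge0 // !mulr_ge0 ?exprn_ge0.
have s2 : sensitivity R m ^+ 2 <= (2 ^+ 13 * z ^+ 9) ^+ 2 by rewrite lerXn2r ?nnegrE // (le_trans s0).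
apply: (@le_trans _ _ (2 ^+ 5 * (2 ^+ 13 * z ^+ 9) ^+ 2 * z)).
  have c5 : 24 <= 2 ^+ 5 :> R by rewrite -natrX ler_nat.
  have sq0 : 0 <= sensitivity R m ^+ 2 := exprn_ge0 _ s0.
  by apply: ler_pM m0 _ m2; [rewrite mulr_ge0 | apply: ler_pM].
have -> : 2 ^+ 5 * (2 ^+ 13 * z ^+ 9) ^+ 2 * z = 2 ^+ 18 * (2 ^+ 13 * z ^+ 19).
  by ring.
rewrite ler_pM2l ?exprn_gt0 // (_ : 40 = 13 + (8 + 19))%N // !exprD.
rewrite ler_pM ?mulr_ge0 ?exprn_ge0 //; first by rewrite lerXn2r ?nnegrE.
by rewrite ler_peMl ?exprn_ge0 // exprn_ege1 //; lra.
Qed.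

Lemma log2_lt (R : realType) (n k : nat) : (0 < n)%N -> (n < 2 ^ k)%N ->
  log2 n%:R < k%:R :> R.
Proof.
move=> n0 nk; have l2 : 0 < ln 2 :> R by rewrite ln_gt0 // ltr1n.
rewrite /log2 ltr_pdivrMr // mulr_natl -lnXn // ltr_ln ?posrE ?ltr0n ?exprn_gt0 //.
by rewrite -natrX ltr_nat.
Qed.

Theorem theorem4p1 (R : realType) :
  exists C0 C : R, 0 < C0 /\ 0 < C /\
    forall (n : nat) (q : distr R 'I_n) (eps delta : R),
      (2 <= n)%N ->
      0 <= eps <= 1 -> 0 <= delta <= 1 ->
      C0 / Num.sqrt (log2 n%:R) <= delta ->
      exists (s : nat) (A : algorithm R 'I_n s),
        s%:R <= C * (n%:R / (delta ^+ 2 * log2 n%:R)) /\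
        distinguishes A (perm_class q)
          [set p | dTV p q <= eps]
          [set p | eps + delta < dTV p q].
Proof.
(* [C0 = 2 ^ 6] makes [log2 n >= 2 ^ 12], so that [m >= 2], and puts
   [(24 / d) ^+ 2] below [threshold]; [C = 2 ^ 20 * 2 ^ 7], where
   [log2 n <= 80 * m <= 2 ^ 7 * m]. *)
exists (2 ^+ 6), (2 ^+ 27); split; [exact: exprn_gt0|split; first exact: exprn_gt0].
move=> n q e d n2 _ /andP[d_ge0 d1]; set L : R := log2 n%:R => hd.
have n0 : (0 < n)%N by apply: leq_trans n2.
have L0 : 0 < L by rewrite divr_gt0 // ln_gt0 // ltr1n.
have sL : 0 < Num.sqrt L by rewrite sqrtr_gt0.
have d0 : 0 < d by apply: lt_le_trans hd; rewrite divr_gt0 // exprn_gt0.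
have dL : 2 ^+ 12 <= d ^+ 2 * L.
  rewrite -(sqr_sqrtr (ltW L0)) -exprMn (exprM _ 6 2) lerXn2r ?nnegrE ?exprn_ge0 //.
    by rewrite mulr_ge0 // ltW.
  by rewrite -ler_pdivrMr.
have d2 : d ^+ 2 <= 1 by rewrite exprn_ile1.
have d2_gt0 : 0 < d ^+ 2 by rewrite exprn_gt0.
have L12 : 2 ^+ 12 <= L by apply: (le_trans dL); rewrite ler_piMl // ltW.
(* [m] is the logarithm of [n] in base [2 ^ 40], rounded down. *)
pose k := trunc_log 2 n; pose m := (k %/ 40)%N.
have [k1 k2] : (2 ^ k <= n)%N /\ (n < 2 ^ k.+1)%N.
  by have /andP[] := trunc_log_bounds (isT : (1 < 2)%N) n0.
have Lk : L < k.+1%:R by apply: log2_lt.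
have km : (k.+1 <= 40 * m.+1)%N by rewrite mulnC; apply: ltn_ceil.
have m_gt1 : (1 < m)%N.
  rewrite leq_divRL // -ltnS -(ltr_nat R); apply: le_lt_trans Lk.
  by apply: le_trans L12; rewrite -natrX ler_nat.
have m_gt0 : 0 < m%:R :> R by rewrite ltr0n ltnW.
have m_ge1 : 1 <= m%:R :> R by rewrite ler1n ltnW.
have Lm : L <= 80 * m%:R.
  have : k.+1%:R <= 40 * m.+1%:R :> R by rewrite -natrM ler_nat.
  by rewrite -[m.+1%:R]natr1; lra.
have nz : (2 ^+ m) ^+ 40 <= n%:R :> R.
  rewrite -exprM -natrX ler_nat (leq_trans _ k1) // leq_exp2l //.
  exact: leq_trunc_div.
have mz := natr_le_exp2 R m.
have z1 : 1 <= 2 ^+ m :> R by rewrite exprn_ege1 // ler1n.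
have mn : m%:R * m%:R <= n%:R :> R.
  apply: le_trans nz; rewrite (exprD _ 2 38) expr2.
  apply: (@le_trans _ _ (2 ^+ m * 2 ^+ m)); first by rewrite ler_pM.
  by apply: ler_peMr; [rewrite mulr_ge0 // exprn_ge0 | apply: exprn_ege1].
(* Half of this bound survives rounding and is what [total_est_bias] asks for. *)
pose X : R := 2 ^+ 19 * n%:R / (d ^+ 2 * m%:R).
have dm0 : 0 < d ^+ 2 * m%:R by rewrite mulr_gt0.
have X0 : 0 <= X by rewrite divr_ge0 ?mulr_ge0 ?exprn_ge0 // ltW.
have X2 : 2 <= X.
  rewrite ler_pdivlMr //.
  have : d ^+ 2 * m%:R <= m%:R by rewrite ler_piMl // ltW.
  have : m%:R <= n%:R :> R by apply: le_trans mn; rewrite ler_peMr // ltW.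
  have : 2 * n%:R <= 2 ^+ 19 * n%:R :> R by rewrite ler_wpM2r // exprS ler_peMr // exprn_ege1 // ler1n.
  lra.
pose s := Num.truncn X.
have s1 : s%:R <= X by rewrite truncn_le.
have s2 : X < s%:R + 1 by rewrite natr1 truncnS_gt.
have hs : 16 * bias_cst R * n%:R <= d ^+ 2 * m%:R * s%:R.
  have : X * (d ^+ 2 * m%:R) = 2 ^+ 19 * n%:R by rewrite divfK // gt_eqF.
  have : X * (d ^+ 2 * m%:R) <= 2 * s%:R * (d ^+ 2 * m%:R) by rewrite ler_pM2r //; lra.
  by rewrite /bias_cst !exprS expr0; lra.
have h18 : 16 * bias_cst R = 2 ^+ 18 by rewrite /bias_cst !exprS expr0; lra.
rewrite h18 in hs *.
have s_ge : (2 * m <= s)%N.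
  rewrite -(ler_nat R) natrM -(ler_pM2l m_gt0).
  have : d ^+ 2 * m%:R * s%:R <= m%:R * s%:R.
    by rewrite -mulrA ler_piMl // mulr_ge0.
  have : 2 * n%:R <= 2 ^+ 18 * n%:R :> R by rewrite ler_wpM2r // exprS ler_peMr // exprn_ege1 // ler1n.
  lra.
have s_gt0 : (0 < s)%N by rewrite (leq_trans _ s_ge) // muln_gt0 /= ltnW.
have hthr : 24 <= d * Num.sqrt (threshold R m).
  have t0 : 0 <= threshold R m by rewrite /threshold mulr_ge0.
  rewrite -(@ler_sqr _ 24) ?nnegrE ?mulr_ge0 ?sqrtr_ge0 // exprMn sqr_sqrtr //.
  have : d ^+ 2 * L <= d ^+ 2 * (80 * m%:R) by rewrite ler_pM2l.
  have : 2 * 24 ^+ 2 <= 2 ^+ 12 :> R by rewrite -!natrX -natrM ler_nat.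
  by move: dL; rewrite /threshold; move: (2 ^+ 12) (24 ^+ 2) => P Q; lra.
have hsens : 24 * sensitivity R m ^+ 2 <= s%:R * d ^+ 2.
  rewrite -(ler_pM2r m_gt0) (le_trans (sensitivity_le R m_gt1)) //.
  rewrite [X in _ <= X](_ : _ = d ^+ 2 * m%:R * s%:R); last by ring.
  by rewrite (le_trans _ hs) // ler_pM2l // exprn_gt0.
have d01 : 0 < d <= 1 by rewrite d0.
rewrite -h18 in hs.
have [A HA] := tester_correct q m_gt1 s_ge e s_gt0 d01 hthr hs hsens.
exists (s + s)%N, A; split; last exact: HA.
have : (s + s)%:R <= 2 * X by rewrite natrD; lra.
move/le_trans; apply.
have -> : 2 * X = 2 ^+ 20 * n%:R / d ^+ 2 * m%:R^-1.
  by rewrite /X; field; rewrite !gt_eqF.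
have -> : 2 ^+ 27 * (n%:R / (d ^+ 2 * L)) = 2 ^+ 20 * n%:R / d ^+ 2 * (2 ^+ 7 / L).
  by field; rewrite !gt_eqF.
rewrite ler_wpM2l ?divr_ge0 ?mulr_ge0 ?exprn_ge0 // ler_pdivlMr // mulrC ler_pdivrMr //.
by apply: (le_trans Lm); rewrite ler_pM2r // -natrX ler_nat.
Qed.
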